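(* Let $n\ge 3$ and let $K$ be a convex body in $\mathbb{R}^n$ such that all central sections of $K$ are 1-symmetric, i.e. for every linear subspace $H$ of $\mathbb{R}^n$ with $1\le \dim H\le n-1$ the set $K\cap H$ is 1-symmetric as a subset of $H$. Then $K$ is a Euclidean ball.
   Context: A convex body in $\mathbb{R}^n$ is a compact convex set with non-empty interior. For a finite-dimensional Euclidean space $H$ and $A\subseteq H$, the symmetry group of $A$ is the group of all isometries $T$ of $H$ (not necessarily linear) with $TA=A$. The set $A$ is called 1-symmetric if its symmetry group contains the symmetry group of some cube in $H$ (of dimension $\dim H$, with arbitrary center and orientation). *)

(* Defs.v *)
From HB Require Import structures.
From mathcomp Require Import all_boot all_order all_algebra.
From mathcomp Require Import all_classical all_reals all_analysis.

Set Implicit Arguments.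
Unset Strict Implicit.
Unset Printing Implicit Defensive.

Import Order.TTheory GRing.Theory Num.Theory.
Import numFieldNormedType.Exports.

Local Open Scope classical_set_scope.
Local Open Scope ring_scope.

(* The canonical norm on 'rV[R]_n is the sup norm, not the Euclidean one; both
   induce the same topology, used for compactness and interior below. *)
Definition dotp (R : realType) (n : nat) (u v : 'rV[R]_n) : R :=
  \sum_(i < n) u 0 i * v 0 i.

Definition enorm (R : realType) (n : nat) (u : 'rV[R]_n) : R :=
  Num.sqrt (dotp u u).

Definition edist (R : realType) (n : nat) (u v : 'rV[R]_n) : R :=
  enorm (u - v).

Definition convex_body (R : realType) (n : nat) (K : set 'rV[R]_n) : Prop :=
  [/\ compact K, convex_set K & K° !=set0].

Definition euclidean_ball (R : realType) (n : nat) (K : set 'rV[R]_n) : Prop :=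
  exists (c : 'rV[R]_n) (r : R), 0 < r /\ K = [set x | edist x c <= r].

(* A map H -> H is represented by a map of the ambient space that sends H to
   itself; its values outside H are irrelevant. *)
Definition isometry_on (R : realType) (n : nat) (H : {vspace 'rV[R]_n})
    (T : 'rV[R]_n -> 'rV[R]_n) : Prop :=
  set_bij [set` H] [set` H] T /\
  {in H &, forall x y, edist (T x) (T y) = edist x y}.

Definition symmetry_group (R : realType) (n : nat) (H : {vspace 'rV[R]_n})
    (A : set 'rV[R]_n) : set ('rV[R]_n -> 'rV[R]_n) :=
  [set T | isometry_on H T /\ T @` A = A].

Definition cube_in (R : realType) (n : nat) (H : {vspace 'rV[R]_n})
    (Q : set 'rV[R]_n) : Prop :=
  exists (c : 'rV[R]_n) (e : 'I_(\dim H) -> 'rV[R]_n) (r : R),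
    [/\ c \in H, forall i, e i \in H,
        forall i j, dotp (e i) (e j) = (i == j)%:R,
        0 < r &
        Q = [set x | exists t : 'I_(\dim H) -> R,
               (forall i, `|t i| <= r) /\ x = c + \sum_i t i *: e i]].

(* Meant for A included in H. *)
Definition one_symmetric (R : realType) (n : nat) (H : {vspace 'rV[R]_n})
    (A : set 'rV[R]_n) : Prop :=
  exists Q : set 'rV[R]_n,
    cube_in H Q /\ symmetry_group H Q `<=` symmetry_group H A.

(* Main.v *)
Require Import Defs.
From HB Require Import structures.
From mathcomp Require Import all_boot all_order all_algebra.
From mathcomp Require Import all_classical all_reals all_analysis.
From mathcomp Require Import ring lra.
Import Order.TTheory GRing.Theory Num.Theory.
Import numFieldNormedType.Exports.
Local Open Scope classical_set_scope.
Local Open Scope ring_scope.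

(* Only the plane sections are used, and of their symmetries only the quarter
   turn [J] about the center [c(H)] of [K ∩ H].  Let the origin be [p].

   1. [K] is centrally symmetric.  Among the strips [q β <= <N,.> <= β] with
   both sides supporting [K], take one with [q] maximal.  By separation there is
   a point [x] of the face [<N,.> = β] such that [q x] lies in the opposite face.
   In every plane through [p] and [x] the two faces cut chords that are exchanged
   by the half turn about [c(H)].  Either [c(H) = (1 + q)/2 x] for all these
   planes but at most one, and then [K] is symmetric about this point, or the two
   faces contain homothetic triangles, which the equality of the chord lengths
   excludes.

   2. Let [0] be the center of symmetry, [p <> 0] and [e = p/|p|].  Planes through
   [e] have center [0].  If [x] is the point of the complement nearest to an
   interior point [z], a quarter turn in the planes obtained by tilting
   [span(x, e)] shows that [x - z] has no component orthogonal to [x] and [e].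
   Hence rotating [z] about [e] changes its distance to the complement only to the
   second order, that is, not at all: [K] is a body of revolution about [e].

   3. Let [g(h)] be the radius of the disc of [K] at height [h].  In a plane
   through [p] of small slope [ε] to [e], with center at height [x], the half turn
   gives [g(h)^2 - g(2x - h)^2 = 4 ε^2 (x - |p|)(h - x)].  As [ε] tends to [0], [g^2]
   is affine in [h^2], and the quarter turn exchanging [e] with a direction
   orthogonal to it forces [g(h)^2 = r^2 - h^2].

   If [p] is the center of symmetry, quarter turns about it already act
   transitively on directions. *)

Set Implicit Arguments.
Unset Strict Implicit.
Unset Printing Implicit Defensive.

(** * The Euclidean structure of ['rV[R]_n] *)

Ltac vec := apply/rowP => ?; rewrite !mxE; ring.

(** Turns a membership goal into an identity between vectors, left to [vec]. *)
Lemma set_congr (T : Type) (A : set T) u v : A u -> u = v -> A v.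
Proof. by move=> ? <-. Qed.

Section DotProduct.
Context {R : realType} {n : nat}.
Implicit Types (u v w x y z : 'rV[R]_n) (a b c : R) (K : set 'rV[R]_n).

Lemma dotC u v : dotp u v = dotp v u.
Proof. by apply: eq_bigr => i _; rewrite mulrC. Qed.

Lemma dotDl u v w : dotp (u + v) w = dotp u w + dotp v w.
Proof. by rewrite /dotp -big_split; apply: eq_bigr => i _;
  rewrite mxE mulrDl. Qed.

Lemma dotZl a u w : dotp (a *: u) w = a * dotp u w.
Proof. by rewrite /dotp mulr_sumr; apply: eq_bigr => i _;
  rewrite mxE mulrA. Qed.

Lemma dotDr u v w : dotp w (u + v) = dotp w u + dotp w v.
Proof. by rewrite dotC dotDl !(dotC w). Qed.

Lemma dotZr a u w : dotp w (a *: u) = a * dotp w u.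
Proof. by rewrite dotC dotZl (dotC w). Qed.

Lemma dotNl u w : dotp (- u) w = - dotp u w.
Proof. by rewrite -scaleN1r dotZl mulN1r. Qed.

Lemma dotNr u w : dotp w (- u) = - dotp w u.
Proof. by rewrite dotC dotNl dotC. Qed.

Lemma dot0l w : dotp 0 w = 0.
Proof. by rewrite -(scale0r 0) dotZl mul0r. Qed.

Lemma dot0r w : dotp w 0 = 0.
Proof. by rewrite dotC dot0l. Qed.

Definition dotE := (dotDl, dotDr, dotZl, dotZr, dotNl, dotNr, dot0l, dot0r).

Lemma dot_sqrD u v : dotp (u + v) (u + v) = dotp u u + 2 * dotp u v + dotp v v.
Proof. by rewrite !dotE (dotC v u); ring. Qed.

Lemma sqr_coord_le_dot u i : (u 0 i) ^+ 2 <= dotp u u.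
Proof.
rewrite /dotp (bigD1 i) //= -expr2 lerDl sumr_ge0 // => j _.
by rewrite -expr2 sqr_ge0.
Qed.

Lemma dot_ge0 u : 0 <= dotp u u.
Proof. by apply: sumr_ge0 => i _; rewrite -expr2 sqr_ge0. Qed.

Lemma dot_eq0 u : (dotp u u == 0) = (u == 0).
Proof.
apply/eqP/eqP => [u0|->]; last exact: dot0l.
apply/rowP => i; rewrite mxE; apply/eqP; rewrite -sqrf_eq0.
by rewrite eq_le sqr_ge0 -{1}u0 sqr_coord_le_dot.
Qed.

Lemma dot_gt0 u : (0 < dotp u u) = (u != 0).
Proof. by rewrite lt_def dot_ge0 dot_eq0 andbT. Qed.

Lemma dot_le_norm u c : (forall i, `|u 0 i| <= c) -> dotp u u <= n%:R * c ^+ 2.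
Proof.
move=> h; rewrite /dotp mulr_natl -[X in _ *+ X]card_ord -sumr_const.
apply: ler_sum => i _; rewrite -expr2 -(real_normK (num_real (u 0 i))).
by rewrite lerXn2r ?nnegrE // (le_trans _ (h i)).
Qed.

Lemma dist_coord_lt u v c : 0 < c -> dotp (u - v) (u - v) < c ^+ 2 ->
  forall i, `|v 0 i - u 0 i| < c.
Proof.
move=> c0 h i; rewrite distrC -(@ltr_pXn2r _ 2) ?nnegrE ?(ltW c0) //.
rewrite real_normK ?num_real //; apply: le_lt_trans h.
by have := sqr_coord_le_dot (u - v) i; rewrite !mxE.
Qed.

Lemma continuous_dot (T : topologicalType) (f g : T -> 'rV[R]_n) :
  continuous f -> continuous g -> continuous (fun t => dotp (f t) (g t)).
Proof.
move=> cf cg t; rewrite /dotp /=.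
have cc (h : T -> 'rV[R]_n) i : continuous h -> {for t,
  continuous (fun t => h t 0 i)}.
  by move=> ch; apply: (@continuous_comp _ _ _ h (fun M : 'rV[R]_n =>
    M 0 i)); [exact: ch|exact: coord_continuous].
apply: cvg_big => [|i _]; first exact: add_continuous.
by apply: cvgM; exact: cc.
Qed.

Lemma closed_dotP K x : closed K ->
  (forall e, 0 < e -> exists2 y, K y & dotp (y - x) (y - x) < e) -> K x.
Proof.
move=> cK h; apply: cK => B /nbhs_ballP[e /= e0 eB].
have [y Ky d] := h (e ^+ 2) (exprn_gt0 _ e0).
exists y; split => //; apply: eB; split=> // i j.
rewrite (ord1 i) -ball_normE /=.
by apply: (dist_coord_lt e0 d).
Qed.

Lemma interior_dotP K x : K° x ->
  exists2 r, 0 < r & forall y, dotp (y - x) (y - x) < r ^+ 2 -> K y.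
Proof.
move=> /nbhs_ballP[e /= e0 eB]; exists e => // y d; apply: eB; split=> // i j.
by rewrite (ord1 i) -ball_normE /=; exact: (dist_coord_lt e0 d).
Qed.

Lemma compact_dot_bounded K : compact K ->
  exists2 M, 0 < M & forall x, K x -> dotp x x <= M ^+ 2.
Proof.
move=> /compact_bounded[M [_ hM]].
pose c := Num.max M 0 + 1.
have Mc : M < c.
  rewrite /c; have : M <= Num.max M 0 by rewrite le_max lexx.
  by move=> h; lra.
have c0 : 0 < c.
  rewrite /c; have : 0 <= Num.max M 0 by rewrite le_max lexx orbT.
  by move=> h; lra.
have := hM _ Mc => {}hM.
exists ((n%:R + 1) * c) => [|x Kx]; first by have := ler0n R n; nra.
have : dotp x x <= n%:R * c ^+ 2.
  apply: dot_le_norm => i; apply: le_trans (hM x Kx).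
  rewrite [leRHS]/Num.norm /= mx_normrE.
  by apply/bigmax_geP; right => /=; exists (0, i).
by have := ler0n R n; nra.
Qed.

Lemma dot_bounded_compact K M : closed K ->
  (forall x, K x -> dotp x x <= M) -> compact K.
Proof.
move=> cK hM; apply: bounded_closed_compact => //.
exists (`|M| + 1); split; first by rewrite num_real.
move=> c Mc x /hM xM; have M0 := normr_ge0 M; have c0 : 0 < c by lra.
rewrite /Num.norm /= mx_normrE.
apply/bigmax_leP; split => [|[i j] _]; first exact: ltW.
rewrite /= (ord1 i) -(@ler_pXn2r _ 2) ?nnegrE ?(ltW c0) // real_normK
  ?num_real //.
have := sqr_coord_le_dot x j; have := ler_norm M; nra.
Qed.

Lemma closure_dotP K x : closure K x <->
  (forall e, 0 < e -> exists2 y, K y & dotp (y - x) (y - x) < e).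
Proof.
split=> [cK e e0|]; last first.
  move=> h; apply: closed_dotP => [|e e0]; first exact: closed_closure.
  by have [y Ky d] := h e e0; exists y => //; exact: subset_closure.
have e1 : 0 < e / (n%:R + 1) by rewrite divr_gt0 // ltr_wpDl.
have r0 : 0 < Num.sqrt (e / (n%:R + 1)) by rewrite sqrtr_gt0.
have [y [Ky yB]] := cK _ (nbhsx_ballx x _ r0).
exists y => //.
apply: (@le_lt_trans _ _ (n%:R * Num.sqrt (e / (n%:R + 1)) ^+ 2)).
  apply: dot_le_norm => i; rewrite !mxE.
  have [_ /(_ 0 i)] := yB; rewrite -ball_normE /= distrC; exact: ltW.
rewrite sqr_sqrtr ?ltW // mulrCA gtr_pMr // ltr_pdivrMr ?mul1r ?ltrDl
  ?ltr_wpDl //.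
Qed.

Lemma nearest_point K z : closed K -> K !=set0 ->
  exists2 x, K x &
    forall y, K y -> dotp (x - z) (x - z) <= dotp (y - z) (y - z).
Proof.
move=> cK [q Kq].
pose f y := dotp (y - z) (y - z).
have cf : continuous f.
  have cs : continuous (fun y => y - z).
    move=> y; apply: (@continuousB R _ 'rV[R]_n id (fun=> z) y) => //.
    exact: cst_continuous.
  exact: continuous_dot.
pose A := K `&` [set y | f y <= f q].
have cA : closed A.
  apply: closedI => //.
  apply: (@preimage_closed _ _ f [set t | t <= f q]) => //; exact: closed_le.
have kA : compact A.
  apply: (@dot_bounded_compact _ (2 * f q + 2 * dotp z z)) => // y [_ /=].
  have := dot_ge0 (y - 2 *: z); rewrite /f !dotE (dotC z y); lra.
have A0 : A !=set0 by exists q; split => /=.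
have [x /set_mem[Kx _] xm] := EVT_min_rV A0 kA (continuous_subspaceT cf).
exists x => // y Ky; case: (leP (f y) (f q)) => fy.
  by apply: xm; apply/mem_set; split.
by apply: le_trans (ltW fy); apply: xm; apply/mem_set; split => /=.
Qed.

(** Otherwise the squared distance would have a negative derivative at [w] along [u]. *)
Lemma nearest_obtuse q w u :
  (forall m, 0 <= m <= 1 ->
    dotp (w - q) (w - q) <= dotp (w + m *: u - q) (w + m *: u - q)) ->
  dotp (q - w) u <= 0.
Proof.
move=> h; rewrite leNgt; apply/negP => h0.
have W0 := dot_ge0 u; have D0 : 0 < dotp u u + 1 by lra.
(* With this [m] the linear term exceeds the quadratic one; the [+ 1] keeps the denominator
   positive. *)
pose m := Num.min 1 (dotp (q - w) u / (dotp u u + 1)).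
have m0 : 0 < m by rewrite lt_min ltr01 divr_gt0.
have m1 : m <= 1 by rewrite ge_min lexx.
have : m <= dotp (q - w) u / (dotp u u + 1) by rewrite ge_min lexx orbT.
rewrite ler_pdivlMr // => m2.
have := h m; rewrite (ltW m0) m1 => /(_ isT).
have -> : w + m *: u - q = (w - q) + m *: u by vec.
have E : dotp (w - q) u = - dotp (q - w) u by rewrite -dotNl opprB.
rewrite [leRHS]dot_sqrD !(dotZl, dotZr) E; nra.
Qed.

Lemma linear_max K u : compact K -> K !=set0 ->
  exists2 x, K x & forall y, K y -> dotp u y <= dotp u x.
Proof.
move=> kK K0.
have cf : continuous (dotp u).
  apply: (@continuous_dot 'rV[R]_n (fun=> u) id);
    [exact: cst_continuous|by move=> ?].
have [x /set_mem Kx xm] := EVT_max_rV K0 kK (continuous_subspaceT cf).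
by exists x => // y Ky; apply: xm; exact: mem_set.
Qed.

Lemma dot_normalized u : u != 0 ->
  dotp ((Num.sqrt (dotp u u))^-1 *: u) ((Num.sqrt (dotp u u))^-1 *: u) = 1.
Proof.
rewrite -dot_gt0 => u0; rewrite !dotE mulrA -invfM -expr2 sqr_sqrtr ?ltW //.
by rewrite mulVf // gt_eqF.
Qed.

(** The matrix with columns [u], [v] has rank at most 2, less than [n], so its left kernel is
    nonzero. *)
Lemma unit_orthogonal2 u v : (3 <= n)%N ->
  exists w, [/\ dotp w w = 1, dotp w u = 0 & dotp w v = 0].
Proof.
move=> n3; pose A := (col_mx u v)^T.
have rA : (0 < \rank (kermx A))%N.
  rewrite mxrank_ker subn_gt0.
  by apply: leq_ltn_trans (rank_leq_col A) _; rewrite addn1.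
have : nz_row (kermx A) != 0 by rewrite nz_row_eq0 -mxrank_eq0 -lt0n.
set w0 := nz_row _ => w0N.
have w0A : w0 *m A = 0 by apply: sub_kermxP; exact: nz_row_sub.
have dotM x y : dotp x y = (x *m y^T) 0 0.
  by rewrite mxE; apply: eq_bigr => i _; rewrite mxE.
have [hu hv] : dotp w0 u = 0 /\ dotp w0 v = 0.
  have := w0A; rewrite /A tr_col_mx mul_mx_row -[0]row_mx0.
  by move=> /eq_row_mx [h1 h2]; rewrite !dotM h1 h2 mxE.
exists ((Num.sqrt (dotp w0 w0))^-1 *: w0).
by rewrite dot_normalized // !dotE hu hv mulr0.
Qed.

Lemma convex_combP K x y s : convex_set K -> K x -> K y -> 0 <= s <= 1 ->
  K ((1 - s) *: x + s *: y).
Proof.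
move=> cK Kx Ky /andP[s0 s1].
have /set_mem := cK y x (Itv01 s0 s1) (mem_set Ky) (mem_set Kx).
by rewrite addrC.
Qed.

End DotProduct.

(** * Profiles of bodies of revolution *)

(** To be used with [c] the grid point just below [a], in a grid of step [2 * y]: the error in the
    square is linear in [y]. *)
Lemma sqr_sub_itv (R : realFieldType) (a b c y : R) : 0 < y -> 0 <= c ->
  c <= a -> a <= c + 2 * y -> a <= b -> y <= b ->
  0 <= a ^+ 2 - (c ^+ 2 - y ^+ 2) <= 5 * b * y.
Proof.
move=> y0 c0 ca ac ab yb.
have h1 : 0 <= (a - c) * (a + c) by rewrite mulr_ge0; lra.
have h2 : (a - c) * (a + c) <= 2 * y * (2 * b) by rewrite ler_pM; lra.
have h3 : 0 <= y ^+ 2 by exact: sqr_ge0.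
have h4 : y ^+ 2 <= y * b by rewrite expr2 ler_pM2l.
have -> : a ^+ 2 - (c ^+ 2 - y ^+ 2) = (a - c) * (a + c) + y ^+ 2 by ring.
by clear -h1 h2 h3 h4; apply/andP; split; lra.
Qed.

Lemma normM_le (R : realFieldType) (a c A C : R) :
  `|a| <= A -> 0 <= c <= C -> `|a * c| <= A * C.
Proof. by move=> hA /andP[c0 hC]; rewrite normrM ler_pM // ger0_norm. Qed.

Lemma norm_sub_le_itv (R : realFieldType) (a b c : R) :
  0 <= a <= c -> 0 <= b <= c -> `|a - b| <= c.
Proof. by move=> /andP[? ?] /andP[? ?]; rewrite ler_norml; lra. Qed.

(* [H], [Q], [U], [V], [Y] stand for the values of [g ^+ 2] at [h], [k], at the
   grid points [u], [v] below them and at the first grid point [y]; [u] and [v]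
   themselves stand for [u ^+ 2 - y ^+ 2] and [v ^+ 2 - y ^+ 2]. *)
Lemma cross_estimate (R : realFieldType) (h k u v y b r2 b2 La H Q U V Y : R) :
  0 <= h <= b2 -> 0 <= k <= b2 -> u <= h -> h - u <= 5 * b * y ->
  v <= k -> k - v <= 5 * b * y ->
  `|H - U| <= La * (2 * y) -> `|Q - V| <= La * (2 * y) -> `|Y - r2| <= La * y ->
  0 <= U <= r2 -> 0 <= V <= r2 -> 0 <= Y <= r2 -> (U - Y) * v = (V - Y) * u ->
  `|(H - r2) * k - (Q - r2) * h| <= y * (10 * r2 * b + 6 * La * b2).
Proof.
move=> h2 k2 uh sh vk sk Lh Lk Ly U2 V2 Y2 X.
have -> : (H - r2) * k - (Q - r2) * h = (U - Y) * (k - v)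
    + ((H - U) + (Y - r2)) * k - (V - Y) * (h - u)
    - ((Q - V) + (Y - r2)) * h.
  have -> : (U - Y) * (k - v) = (U - Y) * k - (V - Y) * u by rewrite -X; ring.
  by ring.
have sk' : 0 <= k - v <= 5 * b * y by rewrite subr_ge0 vk.
have sh' : 0 <= h - u <= 5 * b * y by rewrite subr_ge0 uh.
have T1 := normM_le (norm_sub_le_itv U2 Y2) sk'.
have T3 := normM_le (norm_sub_le_itv V2 Y2) sh'.
have T2 := normM_le (le_trans (ler_normD _ _) (lerD Lh Ly)) k2.
have T4 := normM_le (le_trans (ler_normD _ _) (lerD Lk Ly)) h2.
have -> : y * (10 * r2 * b + 6 * La * b2) = r2 * (5 * b * y)
   + (La * (2 * y) + La * y) * b2 + r2 * (5 * b * y)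
   + (La * (2 * y) + La * y) * b2 by ring.
apply: le_trans (ler_normB _ _) (lerD _ T4).
apply: le_trans (ler_normB _ _) (lerD _ T3).
exact: le_trans (ler_normD _ _) (lerD T1 T2).
Qed.

Section Profile.
Context (R : realType).
Variables (r t : R) (g : R -> R).
Hypotheses (r0 : 0 < r) (t0 : 0 < t).
Hypothesis g_ge0 : forall h, `|h| <= r -> 0 <= g h.
Hypothesis g_even : forall h, `|h| <= r -> g (- h) = g h.
Hypothesis g_concave : forall h k s, `|h| <= r -> `|k| <= r -> 0 <= s <= 1 ->
  (1 - s) * g h + s * g k <= g ((1 - s) * h + s * k).
Hypothesis g_le : forall h, `|h| <= r -> g h <= r.
(** Source: in a plane through the axis, the quarter turn about 0 followed by the central symmetry
    carries [(h, g h)] to [(g h, - h)]. *)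
Hypothesis g_swap : forall h, `|h| <= r -> `|h| <= g (g h).
Hypothesis g0 : g 0 = r.
(** [eps] is the slope of a plane through the axis point of height [t], and [x] is the height of the
    center of its section. The premise says that the plane meets the disc at height [h]; the
    conclusion equates the squared half chords at [h] and [2 * x - h]. *)
Hypothesis g_section : forall eps, 0 < eps -> exists x, forall h, `|h| <= r ->
  eps ^+ 2 * (h - t) ^+ 2 <= g h ^+ 2 -> `|2 * x - h| <= r /\
  g h ^+ 2 - g (2 * x - h) ^+ 2 = 4 * eps ^+ 2 * (x - t) * (h - x).

(** By evenness both ends of [[-v, v]] have the value [g v], and concavity does the rest. *)
Lemma profile_antitone u v : 0 <= u <= v -> v <= r -> g v <= g u.
Proof.
move=> /andP[u0 uv] vr; have [v0|v0] := eqVneq v 0.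
  by have -> : u = v by lra.
have vp : 0 < v by lra.
have nv : `|v| <= r by rewrite ger0_norm // ltW.
have hs : 0 <= (u + v) / (2 * v) <= 1.
  by rewrite divr_ge0 ?ler_pdivrMr /=; lra.
have nv' : `|- v| <= r by rewrite normrN.
have := g_concave nv' nv hs; rewrite g_even //.
have -> : (1 - (u + v) / (2 * v)) * - v + (u + v) / (2 * v) * v = u by field.
by move=> /le_trans-/(_ _ (lexx _)); lra.
Qed.

Lemma profile_lower u v : 0 <= u <= v -> v <= r -> u < r ->
  g u * (r - v) <= g v * (r - u).
Proof.
move=> /andP[u0 uv] vr ur; have d0 : 0 < r - u by lra.
have nu : `|u| <= r by rewrite ger0_norm // ltW.
have nr : `|r| <= r by rewrite ger0_norm // ltW.
have hs : 0 <= (v - u) / (r - u) <= 1.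
  by rewrite divr_ge0 ?ler_pdivrMr /=; lra.
have := g_concave nu nr hs.
have -> : (1 - (v - u) / (r - u)) * u + (v - u) / (r - u) * r = v.
  by field; rewrite gt_eqF.
have -> : 1 - (v - u) / (r - u) = (r - v) / (r - u) by field; rewrite gt_eqF.
move=> h; have gr := g_ge0 nr; have /andP[hs0 _] := hs.
have : (r - v) / (r - u) * g u <= g v by have := mulr_ge0 hs0 gr; lra.
by rewrite mulrAC ler_pdivrMr // mulrC.
Qed.

Lemma profile_ge h : `|h| <= r -> r - `|h| <= g h.
Proof.
move=> hr; have -> : g h = g `|h|.
  by case: (ger0P h) => // h0; rewrite g_even.
have := @profile_lower 0 `|h|;
  rewrite normr_ge0 lexx g0 subr0 => /(_ isT hr r0).
by rewrite mulrC ler_pM2r.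
Qed.

(** The chord from [(u, g u)] to [(r, 0)] lies below the graph, so [g] falls on [[0, b]] with slope
    at most [r / (r - b)]; squaring costs a factor of at most [2 * r]. *)
Lemma profile_lipschitz b u v : b < r -> 0 <= u <= b -> 0 <= v <= b ->
  `|g u ^+ 2 - g v ^+ 2| <= 2 * r ^+ 2 / (r - b) * `|u - v|.
Proof.
move=> br; have d0 : 0 < r - b by lra.
wlog uv : u v / u <= v => [hw ub vb|/andP[u0 ub] /andP[v0 vb]].
  case: (leP u v) => [|/ltW] h; first exact: hw.
  by rewrite distrC (distrC u); exact: hw.
have nu : `|u| <= r by rewrite ger0_norm //; lra.
have nv : `|v| <= r by rewrite ger0_norm //; lra.
have gu := g_le nu; have gu0 := g_ge0 nu; have gv0 := g_ge0 nv.
have huv : 0 <= u <= v by rewrite u0.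
have vr : v <= r by lra.
have gvu := profile_antitone huv vr.
have ur : u < r by lra.
have := profile_lower huv vr ur => h.
rewrite (ger0_norm (_ : 0 <= g u ^+ 2 - g v ^+ 2)); last by nra.
rewrite distrC (ger0_norm (_ : 0 <= v - u)); last by lra.
rewrite mulrAC ler_pdivlMr //.
have h1 : (g u - g v) * (r - b) <= r * (v - u).
  apply: (@le_trans _ _ ((g u - g v) * (r - u))); first by nra.
  by nra.
have -> : (g u ^+ 2 - g v ^+ 2) * (r - b) = (g u - g v) * (r - b) * (g u + g
  v) by ring.
have : 0 <= (g u - g v) * (r - b) by rewrite mulr_ge0; lra.
by nra.
Qed.

(** With [y] the distance of the center from height 0, evenness turns the reflection [2 * x - h]
    into a shift by [2 * y]. The section identity becomes a recursion along the odd multiples of [y]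
    with affine increments, whose solution is quadratic. *)
Lemma profile_grid eps : 0 < eps -> eps * (r + t) < r ->
  exists y k, [/\ 0 < y, 2 * y <= eps * (r + t) &
    forall j : nat, (2 * j%:R + 1) * y <= r - eps * (r + t) ->
    g ((2 * j%:R + 1) * y) ^+ 2 =
      g y ^+ 2 + k * (((2 * j%:R + 1) * y) ^+ 2 - y ^+ 2)].
Proof.
move=> e0 ec; set c := eps * (r + t) in ec *.
have c0 : 0 < c by rewrite mulr_gt0 ?addr_gt0.
have [x hx] := g_section e0.
(* Since [g h >= r - |h| >= c >= eps * |h - t|], the tilted plane meets all these discs. *)
have cond h : `|h| <= r - c -> `|2 * x - h| <= r /\
  g h ^+ 2 - g (2 * x - h) ^+ 2 = 4 * eps ^+ 2 * (x - t) * (h - x).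
  move=> hr; have hr' : `|h| <= r by lra.
  apply: hx => //; have h1 := profile_ge hr'.
  rewrite -exprMn -(real_normK (num_real (eps * _))) lerXn2r ?nnegrE //;
    first exact: g_ge0.
  rewrite normrM (gtr0_norm e0); apply: le_trans h1;
    apply: (@le_trans _ _ c); last by lra.
  rewrite /c ler_pM2l //; apply: le_trans (ler_normB _ _) _.
  by rewrite (gtr0_norm t0) lerD2r.
have rc : 0 < r - c by lra.
have n1 : `|r - c| <= r - c by rewrite gtr0_norm.
have n2 : `|- (r - c)| <= r - c by rewrite normrN.
have [] := cond _ n1; rewrite ler_norml => /andP[x1 _] E1.
have [] := cond _ n2; rewrite ler_norml => /andP[_ x2] _.
(* For a center at height 0, evenness makes the left side of [E1] vanish, while the right side is
   negative. *)
have x0 : x != 0.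
  apply/eqP => x0; move: E1; rewrite x0 mulr0 !sub0r subr0 g_even; last by lra.
  have : 0 < eps ^+ 2 * t * (r - c) by rewrite !mulr_gt0.
  by rewrite subrr; lra.
have [k hk] : exists k, forall h, `|h| <= r - c ->
    g h ^+ 2 - g (h - 2 * `|x|) ^+ 2 = k * (h - `|x|).
  case: (ltrgt0P x) x0 => // xp _.
    exists (4 * eps ^+ 2 * (x - t)) => h /cond [h1 h2].
    by rewrite -h2 -(g_even h1) opprB.
  exists (- (4 * eps ^+ 2 * (x - t))) => h hr.
  have hr' : `|- h| <= r - c by rewrite normrN.
  have [h1 h2] := cond _ hr'; have hr2 : `|h| <= r by lra.
  rewrite -(g_even hr2) (_ : h - 2 * - x = 2 * x - - h); last by ring.
  by rewrite h2; ring.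
have y0 : 0 < `|x| by rewrite normr_gt0.
(* An increment [k * (h - y)] per step [2 * y] amounts to the quadratic coefficient
   [k / (4 * y)]. *)
exists `|x|, (k / (4 * `|x|)); split => //.
  by rewrite (_ : 2 * `|x| = `|2 * x|) ?ler_norml ?normrM ?(ger0_norm (ler0n _
    2)) //; lra.
elim=> [|j IH] hj; first by rewrite mulr0 add0r mul1r subrr mulr0 addr0.
have j0 : (0 : R) <= j%:R by exact: ler0n.
have jE : (j.+1%:R : R) = j%:R + 1 by rewrite -natr1.
move: hj; rewrite jE => hj.
have hj' : (2 * j%:R + 1) * `|x| <= r - c by nra.
have nh : `|(2 * (j%:R + 1) + 1) * `|x| | <= r - c.
  by rewrite ger0_norm //; nra.
have := hk _ nh.
have -> : (2 * (j%:R + 1) + 1) * `|x| - 2 * `|x| = (2 * j%:R + 1) * `|x|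
  by ring.
move=> /eqP; rewrite subr_eq => /eqP ->; rewrite (IH hj'); field.
by rewrite gt_eqF.
Qed.

Lemma grid_point (y h : R) : 0 < y -> y <= h ->
  exists j : nat, (2 * j%:R + 1) * y <= h < (2 * j%:R + 1) * y + 2 * y.
Proof.
move=> y0 yh; have q0 : 0 <= (h - y) / (2 * y) by rewrite divr_ge0; lra.
have /andP := truncn_itv q0; set j := Num.truncn _; rewrite -natr1.
rewrite ler_pdivlMr ?ltr_pdivrMr ?mulr_gt0 // => -[h1 h2].
by exists j; apply/andP; split; lra.
Qed.

(** On the grid [g u ^+ 2 - g y ^+ 2] is exactly proportional to [u ^+ 2 - y ^+ 2]; moving [h] and
    [k] to grid points and [y] to 0 costs an error linear in the step. *)
Lemma profile_near_proportional b h k q : b < r -> 0 < h <= b -> 0 < k <= b ->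
  0 < q -> q <= h -> q <= k -> q <= r - b ->
  `|(g h ^+ 2 - r ^+ 2) * k ^+ 2 - (g k ^+ 2 - r ^+ 2) * h ^+ 2| <=
  q * (10 * r ^+ 2 * b + 6 * (2 * r ^+ 2 / (r - b)) * b ^+ 2).
Proof.
move=> br /andP[h0 hb] /andP[k0 kb] q0 qh qk qb.
have c0 : 0 < r + t by rewrite addr_gt0.
(* For the slope [q / (r + t)] the margin [eps * (r + t)] of the grid is [q]. *)
have [||y [ka [y0 yq hg]]] := @profile_grid (q / (r + t)); rewrite ?divr_gt0 //.
  by rewrite divfK ?gt_eqF //; lra.
rewrite divfK ?gt_eqF // in yq hg.
have yh : y <= h by lra.
have yk : y <= k by lra.
have yb : y <= b by lra.
have yq' : y <= q by lra.
have rng a : 0 <= a <= b -> 0 <= g a ^+ 2 <= r ^+ 2.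
  move=> /andP[a0 ab]; have na : `|a| <= r.
    by rewrite ger0_norm // (le_trans ab) // ltW.
  by rewrite sqr_ge0 lerXn2r ?nnegrE ?g_ge0 ?(ltW r0) // g_le.
have La0 : 0 <= 2 * r ^+ 2 / (r - b).
  by rewrite divr_ge0 ?mulr_ge0 ?sqr_ge0 ?subr_ge0 ?(ltW br) ?(ltW r0).
have near_grid a : y <= a -> a <= b -> q <= r - b -> exists u,
    [/\ u ^+ 2 - y ^+ 2 <= a ^+ 2, a ^+ 2 - (u ^+ 2 - y ^+ 2) <= 5 * b * y,
    `|g a ^+ 2 - g u ^+ 2| <= 2 * r ^+ 2 / (r - b) * (2 * y),
    0 <= g u ^+ 2 <= r ^+ 2 &
    g u ^+ 2 = g y ^+ 2 + ka * (u ^+ 2 - y ^+ 2)].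
  clear h h0 hb k k0 kb qh qk yh yk => ya ab qb'.
  have [i /andP[i1 i2]] := grid_point y0 ya.
  have iq : (2 * i%:R + 1) * y <= r - q by lra.
  have := hg i iq; set u := (_ * y) in i1 i2 * => Eu.
  have yu : y <= u.
    by rewrite -[leLHS]mul1r ler_pM2r // lerDr mulr_ge0.
  have u0 : 0 <= u by lra.
  have ub : 0 <= u <= b by rewrite u0 (le_trans i1).
  have /andP[s1 s2] := sqr_sub_itv y0 u0 i1 (ltW i2) ab (le_trans ya ab).
  exists u; split=> //; last exact: rng.
    by rewrite -subr_ge0.
  apply: le_trans (profile_lipschitz br _ ub) _; first by rewrite (le_trans u0).
  by rewrite ler_wpM2l // ger0_norm; lra.
have [u [u1 u2 Lh Ru Eu]] := near_grid h yh hb qb.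
have [v [v1 v2 Lk Rv Ev]] := near_grid k yk kb qb.
have Ly : `|g y ^+ 2 - r ^+ 2| <= 2 * r ^+ 2 / (r - b) * y.
  have := @profile_lipschitz b y 0 br; rewrite g0 subr0 (gtr0_norm y0).
  by apply; rewrite ?lexx ?(ltW y0) // (le_trans (ltW y0)).
have Ry : 0 <= g y ^+ 2 <= r ^+ 2 by rewrite rng // ltW.
have X : (g u ^+ 2 - g y ^+ 2) * (v ^+ 2 - y ^+ 2) =
    (g v ^+ 2 - g y ^+ 2) * (u ^+ 2 - y ^+ 2) by rewrite Eu Ev; ring.
have b0 : 0 < b := lt_le_trans y0 yb.
have h2 : 0 <= h ^+ 2 <= b ^+ 2.
  by rewrite sqr_ge0 lerXn2r ?nnegrE ?(ltW h0) ?(ltW b0).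
have k2 : 0 <= k ^+ 2 <= b ^+ 2.
  by rewrite sqr_ge0 lerXn2r ?nnegrE ?(ltW k0) ?(ltW b0).
have := cross_estimate h2 k2 u1 u2 v1 v2 Lh Lk Ly Ru Rv Ry X.
move/le_trans; apply; rewrite ler_wpM2r // addr_ge0 //.
  by apply: mulr_ge0 (ltW b0); apply: mulr_ge0 (sqr_ge0 r).
by apply: mulr_ge0 (sqr_ge0 b); apply: mulr_ge0 La0.
Qed.

Lemma profile_proportional h k : 0 < h < r -> 0 < k < r ->
  (g h ^+ 2 - r ^+ 2) * k ^+ 2 = (g k ^+ 2 - r ^+ 2) * h ^+ 2.
Proof.
move=> /andP[h0 hr] /andP[k0 kr].
pose b := Num.max h k; have hb : h <= b by rewrite le_max lexx.
have kb : k <= b by rewrite le_max lexx orbT.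
have br : b < r by rewrite gt_max hr.
have b0 : 0 < b := lt_le_trans h0 hb.
pose B := 10 * r ^+ 2 * b + 6 * (2 * r ^+ 2 / (r - b)) * b ^+ 2.
have B0 : 0 <= B.
  by rewrite addr_ge0 ?mulr_ge0 ?invr_ge0 ?subr_ge0 ?(ltW b0) ?(ltW br) ?(ltW
    r0).
apply/eqP; rewrite -subr_eq0 -normr_eq0 eq_le normr_ge0 andbT leNgt.
apply/negP; set D := `|_| => D0.
have B1 : 0 < B + 1 by rewrite ltr_wpDl.
pose q := Num.min (Num.min (Num.min h k) (r - b)) (D / (B + 1)).
have q0 : 0 < q by rewrite !lt_min h0 k0 subr_gt0 br divr_gt0.
have qh : q <= h by rewrite !ge_min lexx.
have qk : q <= k by rewrite !ge_min lexx !orbT.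
have qb : q <= r - b by rewrite !ge_min lexx !orbT.
have qB : q * B + q <= D.
  by rewrite -{2}[q]mulr1 -mulrDr -ler_pdivlMr // ge_min lexx orbT.
have h0b : 0 < h <= b by rewrite h0.
have k0b : 0 < k <= b by rewrite k0.
have DB : D <= q * B := profile_near_proportional br h0b k0b q0 qh qk qb.
by have := lt_le_trans (ltr_pwDr q0 DB) qB; rewrite ltxx.
Qed.

(** Proportionality gives [g h ^+ 2 = r ^+ 2 + ga * h ^+ 2] below [r]. A tilted section rules out a
    cylinder, and then [g] is an involution, which leaves only [ga = -1]. *)
Lemma profile_circle h : `|h| <= r -> g h ^+ 2 = r ^+ 2 - h ^+ 2.
Proof.
have rp := r0; have tp := t0.
have r2 : 0 < r / 2 < r by lra.
pose ga := (g (r / 2) ^+ 2 - r ^+ 2) / (r / 2) ^+ 2.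
have quad k : 0 <= k < r -> g k ^+ 2 = r ^+ 2 + ga * k ^+ 2.
  move=> /andP[]; rewrite le_eqVlt => /predU1P[<- _|k0 kr].
    by rewrite g0 expr0n mulr0 addr0.
  have hk : 0 < k < r by rewrite k0.
  have := profile_proportional hk r2 => E.
  rewrite /ga mulrAC -E; field; rewrite gt_eqF //.
have ga_le : ga <= 0.
  rewrite /ga mulr_le0_ge0 ?invr_ge0 ?sqr_ge0 // subr_le0.
  have n2 : `|r / 2| <= r by rewrite ger0_norm; lra.
  by have := g_ge0 n2; have := g_le n2; nra.
(* If [g] were constant, the section identity at [h = 0] would put the center at height 0 or [t].
   The slope is small enough to exclude [t], and height 0 contradicts the identity at [r - c]. *)
have gaN : ga != 0.
  apply/eqP => ga0; have c0 : 0 < r + t by rewrite addr_gt0.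
  pose eps := Num.min r t / (r + t).
  have m0 : 0 < Num.min r t by rewrite lt_min r0.
  have mr : Num.min r t <= r by rewrite ge_min lexx.
  have mt : Num.min r t <= t by rewrite ge_min lexx orbT.
  have e0 : 0 < eps / 2 by rewrite !divr_gt0.
  have [x hx] := g_section e0.
  pose c := eps / 2 * (r + t); have cE : c = Num.min r t / 2.
    by rewrite /c /eps; field; rewrite gt_eqF.
  have cond k : `|k| <= r - c -> `|2 * x - k| <= r /\
    g k ^+ 2 - g (2 * x - k) ^+ 2 = 4 * (eps / 2) ^+ 2 * (x - t) * (k - x).
    move=> hk; have hk' : `|k| <= r by lra.
    apply: hx => //; have h1 := profile_ge hk'.
    rewrite -exprMn -(real_normK (num_real (_ * (k - t)))) lerXn2r ?nnegrE //;
      first exact: g_ge0.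
    rewrite normrM (gtr0_norm e0); apply: le_trans h1;
      apply: (@le_trans _ _ c); last by lra.
    rewrite /c ler_pM2l //; apply: le_trans (ler_normB _ _) _.
    by rewrite (gtr0_norm t0) lerD2r.
  have rc : 0 < r - c by lra.
  have n1 : `|r - c| <= r - c by rewrite gtr0_norm.
  have n2 : `|- (r - c)| <= r - c by rewrite normrN.
  have n3 : `|(0 : R)| <= r - c by rewrite normr0 ltW.
  have [] := cond _ n1; rewrite ler_norml => /andP[x1 _] E1.
  have [] := cond _ n2; rewrite ler_norml => /andP[_ x2] _.
  have [_] := cond _ n3; rewrite subr0 sub0r.
  have flat k : `|k| < r -> g k ^+ 2 = r ^+ 2.
    move=> kr; have nk : `|k| <= r by exact: ltW.
    have <- : g `|k| = g k by case: (ger0P k) => // _; rewrite g_even.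
    by rewrite quad ?normr_ge0 // ga0 mul0r addr0.
  rewrite !flat ?normr0 //; last by rewrite ltr_norml; lra.
  rewrite subrr => E0; have e2 : 0 < (eps / 2) ^+ 2 by rewrite exprn_gt0.
  have : (eps / 2) ^+ 2 * (t - x) * x = 0 by lra.
  move=> /eqP; rewrite mulf_eq0 => /orP[|/eqP x0].
    by rewrite mulf_eq0 (gt_eqF e2) /= => /eqP; lra.
  move: E1; rewrite x0 mulr0 !sub0r subr0 g_even; last by lra.
  have : 0 < (eps / 2) ^+ 2 * t * (r - c) by rewrite mulr_gt0 // mulr_gt0.
  by rewrite subrr; lra.
have ga0 : ga < 0 by rewrite lt_neqAle gaN.
(* One inequality is [g_swap] at [k]; the other is [g_swap] at [g k], since [g ^+ 2] is now strictly
   decreasing. *)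
have invol k : 0 < k < r -> k ^+ 2 = r ^+ 2 + ga * (r ^+ 2 + ga * k ^+ 2).
  move=> /andP[k0 kr]; have nk : `|k| <= r by rewrite ger0_norm ltW.
  have kk : 0 <= k < r by rewrite ltW.
  have E1 := quad _ kk; have k2 : 0 < k ^+ 2 by rewrite exprn_gt0.
  have gk0 := g_ge0 nk; have gkr : g k < r.
    by rewrite -(@ltr_pXn2r _ 2) ?nnegrE ?(ltW r0) // E1; nra.
  have gkp : 0 < g k by have := profile_ge nk;
    rewrite ger0_norm ?(ltW k0) //; lra.
  have ngk : `|g k| <= r by rewrite ger0_norm // ltW.
  have hgk : 0 <= g k < r by rewrite gk0.
  have E2 := quad _ hgk; rewrite -E1 -E2.
  have := g_swap nk; rewrite (gtr0_norm k0) => h1.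
  have ggr : g (g k) < r.
    rewrite -(@ltr_pXn2r _ 2) ?nnegrE ?(ltW r0) ?g_ge0 // E2.
    have : 0 < g k ^+ 2 by rewrite exprn_gt0.
    by nra.
  have hgg : 0 <= g (g k) < r by rewrite g_ge0.
  have E3 := quad _ hgg.
  have := g_swap ngk; rewrite (gtr0_norm gkp) => h2.
  apply/eqP; rewrite eq_le; apply/andP; split.
    by rewrite lerXn2r ?nnegrE ?g_ge0 // ltW.
  have : g k ^+ 2 <= g (g (g k)) ^+ 2.
    rewrite lerXn2r ?nnegrE // g_ge0 // ger0_norm ?g_ge0 // ltW //.
  by rewrite E3 E1; nra.
have gam1 : ga = -1.
  have r3 : 0 < r / 3 < r by lra.
  have := invol _ r2; have := invol _ r3;
    have : 0 < r ^+ 2 by rewrite exprn_gt0.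
  rewrite !expr_div_n; move: (r ^+ 2) => q q0 e1 e2.
  have : (1 - ga ^+ 2) * q = 0.
    have : (1 - ga ^+ 2) * q * (4^-1 - 9^-1) = 0 by lra.
    by move=> /eqP; rewrite mulf_eq0 => /orP[/eqP //|/eqP]; lra.
  move=> /eqP; rewrite mulf_eq0 (gt_eqF q0) orbF => /eqP g1.
  have : (1 + ga) * q = 0 by nra.
  by move=> /eqP; rewrite mulf_eq0 (gt_eqF q0) orbF => /eqP; lra.
have main k : 0 <= k <= r -> g k ^+ 2 = r ^+ 2 - k ^+ 2.
  move=> /andP[k0]; rewrite le_eqVlt => /predU1P[->|kr]; last first.
    by rewrite quad ?k0 // gam1 mulN1r.
  rewrite subrr; apply/eqP; rewrite sqrf_eq0; apply/eqP.
  have nr : `|r| <= r by rewrite ger0_norm // ltW.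
  apply/eqP; rewrite eq_le g_ge0 // andbT leNgt; apply/negP => q0.
  have q2 : 0 < g r ^+ 2 by rewrite exprn_gt0.
  have qr : g r ^+ 2 <= r ^+ 2 by have := g_ge0 nr; have := g_le nr; nra.
  (* If [g r] were positive, the formula would give [g m ^+ 2 = g r ^+ 2 / 2] at this [m < r],
     against monotonicity. *)
  pose m := Num.sqrt (r ^+ 2 - g r ^+ 2 / 2).
  have mm : m ^+ 2 = r ^+ 2 - g r ^+ 2 / 2 by rewrite sqr_sqrtr //; lra.
  have m0 : 0 <= m by exact: sqrtr_ge0.
  have mr : m < r by rewrite -(@ltr_pXn2r _ 2) ?nnegrE ?(ltW r0) // mm; lra.
  have hm : 0 <= m <= r by rewrite m0 ltW.
  have := profile_antitone hm (lexx r).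
  rewrite -(@ler_pXn2r _ 2) ?nnegrE ?g_ge0 //; last by rewrite ger0_norm // ltW.
  have hm2 : 0 <= m < r by rewrite m0.
  by rewrite (quad m hm2) gam1 mm; lra.
move=> hr; have <- : g `|h| = g h by case: (ger0P h) => // _; rewrite g_even.
by rewrite main ?normr_ge0 // real_normK ?num_real.
Qed.

End Profile.

(** * Centrally symmetric bodies *)

(** All planes considered pass through [p], which is 0 for [K] and [- m] after recentering at [m];
    [(s0, t0)] locates the center of the section relative to [p]. *)
Definition quarter_turn_sections (R : realType) (n : nat) (L : set 'rV[R]_n)
    (p : 'rV[R]_n) :=
  forall a b, dotp a a = 1 -> dotp b b = 1 -> dotp a b = 0 ->
  exists s0 t0, forall s t, L (p + (s0 + s) *: a + (t0 + t) *: b) ->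
    L (p + (s0 - t) *: a + (t0 + s) *: b).

(** The left side is the change of [|x - z| ^ 2] under the displacement [sg x + (a + sg) eps m],
    where [g] and [be] are the products of [x - z] with [x] and [m]. The first term of [sg] cancels
    the first order in [eps], and the term in [C] beats the rest. *)
Lemma inward_step_lt0 (R : realFieldType) (g be X a eps C W sg : R) :
  0 < g -> 0 <= X -> eps != 0 -> `|eps| <= 1 -> C * `|eps| <= 1 -> 0 <= C ->
  `|a * be / g| + 1 <= W ->
  2 * W * `|be| + W ^+ 2 * X + (`|a| + W) ^+ 2 < 2 * C * g ->
  sg = - a * eps * be / g - C * eps ^+ 2 ->
  2 * (sg * g + (a + sg) * eps * be) + sg ^+ 2 * X + (a + sg) ^+ 2 * eps ^+ 2
    < 0.
Proof.
move=> g0 X0 e0 e1 Ce C0 hW hC sgD.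
pose om := - (a * be / g) - C * eps.
have sgE : sg = eps * om by rewrite sgD /om; field; rewrite gt_eqF.
have omW : `|om| <= W.
  rewrite /om -opprD normrN; apply: le_trans (ler_normD _ _) _.
  by apply: le_trans _ hW; rewrite lerD2l normrM (ger0_norm C0).
have -> : 2 * (sg * g + (a + sg) * eps * be) + sg ^+ 2 * X + (a + sg) ^+ 2 *
  eps ^+ 2
   = eps ^+ 2 * (- (2 * C * g) + 2 * om * be + om ^+ 2 * X + (a + eps * om) ^+
     2).
  by rewrite sgE /om; field; rewrite gt_eqF.
rewrite pmulr_rlt0; last by rewrite lt_def sqrf_eq0 e0 sqr_ge0.
have h1 : om * be <= W * `|be|.
  by rewrite (le_trans (ler_norm _)) // normrM ler_wpM2r.
have W0 : 0 <= W by apply: le_trans omW.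
have h2 : om ^+ 2 <= W ^+ 2.
  by rewrite -(real_normK (num_real om)) lerXn2r.
have h3 : (a + eps * om) ^+ 2 <= (`|a| + W) ^+ 2.
  rewrite -(real_normK (num_real (a + _))) lerXn2r ?nnegrE ?addr_ge0 //.
  rewrite (le_trans (ler_normD _ _)) // lerD2l normrM.
  by rewrite -[leRHS]mul1r ler_pM.
have h4 : om ^+ 2 * X <= W ^+ 2 * X by rewrite ler_wpM2r.
lra.
Qed.

(** Along [k] equal steps the increments add up to at most [C / k]. *)
Lemma quadratic_modulus_const (R : realType) (F : R -> R) C :
  (forall s t, F t <= F s + C * (t - s) ^+ 2) -> F 1 <= F 0.
Proof.
move=> h; rewrite leNgt; apply/negP => hlt.
have step (k i : nat) : (0 < k)%N ->
    F (i%:R / k%:R) <= F 0 + i%:R * C / k%:R ^+ 2.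
  move=> k0; have kN : (k%:R : R) != 0 by rewrite pnatr_eq0 -lt0n.
  elim: i => [|i IH]; first by rewrite !mul0r addr0.
  apply: le_trans (h (i%:R / k%:R) _) _.
  apply: le_trans (lerD IH (lexx _)) _; rewrite le_eqVlt; apply/orP; left.
  by apply/eqP; rewrite -natr1; field.
pose k := (Num.bound (`|C| / (F 1 - F 0))).+1.
have d0 : 0 < F 1 - F 0 by rewrite subr_gt0.
have hk : `|C| / (F 1 - F 0) < k%:R.
  have := archi_boundP (divr_ge0 (normr_ge0 C) (ltW d0)) => /lt_trans; apply.
  by rewrite ltr_nat.
have k0 : (0 : R) < k%:R by rewrite ltr0n.
have := step k k (ltn0Sn _); rewrite divff ?gt_eqF // => h1.
have : k%:R * C / k%:R ^+ 2 = C / k%:R by field; rewrite gt_eqF.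
move=> E; move: h1; rewrite E -lerBlDl ler_pdivlMr // => h1.
move: hk; rewrite ltr_pdivrMr // => hk.
have := ler_norm C; lra.
Qed.

(** Being no farther from [z] than [q] is, [x] has a norm bounded in terms of [q] and [z]; this
    yields a constant uniform under rotation of [z]. *)
Lemma dot_le_of_closer (R : realType) (n : nat) (x z q w : 'rV[R]_n) :
  dotp (x - z) (x - z) <= dotp (q - z) (q - z) ->
  2 * dotp x w <= 4 * dotp q q + 6 * dotp z z + dotp w w.
Proof.
have := dot_ge0 (x - w); have := dot_ge0 (x - 2 *: z); have := dot_ge0 (q + z).
rewrite !dot_sqrD !(dotNl, dotNr, dotZl, dotZr); lra.
Qed.

Section SymmetricBody.
Context (R : realType) (n : nat).
Variables (L : set 'rV[R]_n) (p : 'rV[R]_n) (M r0 : R).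
Hypothesis n3 : (3 <= n)%N.
Hypothesis L_sym : forall x, L x -> L (- x).
Hypothesis L_conv : forall x y s,
  0 <= s <= 1 -> L x -> L y -> L ((1 - s) *: x + s *: y).
Hypothesis L_closed : forall x,
  (forall e, 0 < e -> exists2 y, L y & dotp (y - x) (y - x) < e) -> L x.
Hypothesis L_bounded : forall x, L x -> dotp x x <= M ^+ 2.
Hypothesis r0_gt0 : 0 < r0.
Hypothesis L_ball : forall x, dotp x x < r0 ^+ 2 -> L x.
Hypothesis L_turn : quarter_turn_sections L p.

Lemma L_0 : L 0.
Proof. by apply: L_ball; rewrite dot0l exprn_gt0. Qed.

(** The plane passes through 0, so its section is symmetric about 0 and about its own center
    [(c1, c2)]. The two half turns compose to a translation by twice the center, which boundedness
    forces to be trivial. *)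
Lemma section_center0 a b p1 p2 :
  dotp a a = 1 -> dotp b b = 1 -> dotp a b = 0 -> p = p1 *: a + p2 *: b ->
  forall s t, L (s *: a + t *: b) -> L (- t *: a + s *: b).
Proof.
move=> aa bb ab pE; have [s0 [t0 h]] := L_turn aa bb ab.
pose c1 := p1 + s0; pose c2 := p2 + t0.
have rot u v : L (u *: a + v *: b) -> L ((c1 + c2 - v) *: a + (c2 - c1 + u) *:
  b).
  move=> Luv; have /h : L (p + (s0 + (u - c1)) *: a + (t0 + (v - c2)) *: b).
    by apply: (set_congr Luv); rewrite pE /c1 /c2; vec.
  by move=> h2; apply: (set_congr h2); rewrite pE /c1 /c2; vec.
have tr u v : L (u *: a + v *: b) -> L ((u - 2 * c1) *: a + (v - 2 * c2) *: b).
  by move=> /rot/rot/L_sym h2; apply: (set_congr h2); vec.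
have it (k : nat) : L ((- (2 * c1 * k%:R)) *: a + (- (2 * c2 * k%:R)) *: b).
  elim: k => [|k /tr h2]; first by apply: (set_congr L_0); vec.
  by apply: (set_congr h2); rewrite -natr1; vec.
have q0 : 0 <= c1 ^+ 2 + c2 ^+ 2 by rewrite addr_ge0 ?sqr_ge0.
have : c1 ^+ 2 + c2 ^+ 2 = 0.
  apply/eqP; rewrite eq_le q0 andbT leNgt; apply/negP => qp.
  pose k := Num.bound (M ^+ 2 / (c1 ^+ 2 + c2 ^+ 2)).
  have : M ^+ 2 / (c1 ^+ 2 + c2 ^+ 2) < k%:R.
    by apply: archi_boundP; rewrite divr_ge0 ?sqr_ge0.
  rewrite ltr_pdivrMr // => hk.
  have := L_bounded (it k); rewrite !dotE aa bb (dotC b) ab => hb.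
  have k1 : (k%:R : R) <= k%:R ^+ 2.
    by rewrite -natrX ler_nat; case: (k) => // m;
      rewrite -{1}(expn1 m.+1) leq_pexp2l.
  by have := sqr_ge0 M; nra.
move=> /eqP; rewrite paddr_eq0 ?sqr_ge0 // !sqrf_eq0 =>
  /andP[/eqP c10 /eqP c20] s t.
by move=> /rot; rewrite c10 c20 => h2; apply: (set_congr h2); vec.
Qed.

(** In the tilted plane [p + span(x + eps m, y)] the quarter turn makes a chord along [x + eps m]
    parallel to [y]. Averaged with its mirror image it is centered at 0, and the quarter turn of
    [span(x, y)] lays it along [x], where its half length is at most [|x|]. *)
Lemma chord_le x y m p1 p2 s1 s2 eps :
  dotp x y = 0 -> dotp x m = 0 -> dotp y m = 0 -> dotp y y = dotp x x ->
  0 < dotp x x -> dotp m m = 1 -> p = p1 *: x + p2 *: y ->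
  (forall s, 1 < s -> ~ L (s *: x)) ->
  L (p1 *: x + s1 *: (x + eps *: m)) -> L (p1 *: x - s2 *: (x + eps *: m)) ->
  (s1 + s2) ^+ 2 * (dotp x x + eps ^+ 2) <= 4 * dotp x x.
Proof.
move=> xy xm ym yy X0 mm pE xN LA LB.
pose d := x + eps *: m; have dd : dotp d d = dotp x x + eps ^+ 2.
  by rewrite /d !dotE mm (dotC m) xm; ring.
have D0 : 0 < dotp d d by rewrite dd ltr_pwDl ?sqr_ge0.
pose D := Num.sqrt (dotp d d); pose X := Num.sqrt (dotp x x).
have D1 : 0 < D by rewrite sqrtr_gt0.
have X1 : 0 < X by rewrite sqrtr_gt0.
have DD : D ^+ 2 = dotp d d by rewrite sqr_sqrtr // ltW.
have XX : X ^+ 2 = dotp x x by rewrite sqr_sqrtr // ltW.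
have DN : D != 0 by rewrite gt_eqF.
have XN : X != 0 by rewrite gt_eqF.
pose a := D^-1 *: d; pose b := X^-1 *: y; pose a' := X^-1 *: x.
have aa : dotp a a = 1 by rewrite !(dotZl, dotZr) -DD; field.
have bb : dotp b b = 1 by rewrite !(dotZl, dotZr) yy -XX; field.
have aa' : dotp a' a' = 1 by rewrite !(dotZl, dotZr) -XX; field.
have ab : dotp a b = 0.
  by rewrite /a /b /d !dotE xy (dotC m) ym; ring.
have ab' : dotp a' b = 0 by rewrite !dotE xy; ring.
have [s0 [t0 h]] := L_turn aa bb ab.
have LA' : L (p + (s0 - (- p2 * X - t0)) *: a + (t0 + (s1 * D - s0)) *: b).
  by apply: h; apply: (set_congr LA); rewrite pE /a /b /d;
    apply/rowP => ?; rewrite !mxE; field; rewrite DN XN.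
have LB' : L (p + (s0 - (- p2 * X - t0)) *: a + (t0 + (- s2 * D - s0)) *: b).
  by apply: h; apply: (set_congr LB); rewrite pE /a /b /d;
    apply/rowP => ?; rewrite !mxE; field; rewrite DN XN.
have half : 0 <= (2^-1 : R) <= 1 by lra.
have Lb : L (0 *: a' + ((s1 + s2) * D / 2) *: b).
  apply: (set_congr (L_conv half LA' (L_sym LB'))).
  by apply/rowP => ?; rewrite !mxE; field; rewrite XN DN.
have pE' : p = (p1 * X) *: a' + (p2 * X) *: b.
  by rewrite pE /a' /b; apply/rowP => ?; rewrite !mxE; field.
have Lx : L (((s1 + s2) * D / (2 * X)) *: x).
  have h2 := L_sym (section_center0 aa' bb ab' pE' Lb); apply: (set_congr h2).
  by rewrite /a'; apply/rowP => ?; rewrite !mxE; field.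
rewrite -dd -DD -XX leNgt; apply/negP => hlt.
have hq : 1 < `|(s1 + s2) * D / (2 * X)|.
  rewrite -(@ltr_pXn2r _ 2) ?nnegrE // expr1n real_normK ?num_real //.
  rewrite expr_div_n ltr_pdivlMr ?exprn_gt0 ?mulr_gt0 // !exprMn; lra.
move: hq; case: (ger0P ((s1 + s2) * D / (2 * X))) => _ hq.
  exact: (xN _ hq Lx).
by apply: (xN _ hq); rewrite scaleNr; exact: L_sym.
Qed.

(** * Points of the complement nearest to a given point *)

Let Cc := closure (~` L).

Lemma not_closure_setC z : ~ Cc z -> L z.
Proof. by move=> h; apply: contrapT => Lz; apply: h; exact: subset_closure. Qed.

(** The homothety about [x] with ratio [s] shrinks the ball around [g] to a ball of [L] around the
    intermediate point. *)
Lemma interior_between x g e s : L x -> 0 < e ->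
  (forall y, dotp (y - g) (y - g) < e ^+ 2 -> L y) -> 0 < s <= 1 ->
  ~ Cc ((1 - s) *: x + s *: g).
Proof.
move=> Lx e0 Bg /andP[s0 s1] /closure_dotP /(_ ((s * e) ^+ 2)).
case=> [|y nLy d]; first by rewrite exprn_gt0 // mulr_gt0.
have sN : s != 0 by rewrite gt_eqF.
apply: nLy; pose g' := g + s^-1 *: (y - ((1 - s) *: x + s *: g)).
have Lg' : L g'.
  set w := y - _ in d *; apply: Bg.
  have -> : g' - g = s^-1 *: w by rewrite /g'; vec.
  move: d; rewrite exprMn !(dotZl, dotZr) => d.
  rewrite mulrA -invfM mulrC ltr_pdivrMr ?mulr_gt0 //.
  by rewrite -expr2 mulrC.
have s01 : 0 <= s <= 1 by rewrite ltW.
apply: (set_congr (L_conv s01 Lx Lg')).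
by apply/rowP => ?; rewrite !mxE; field.
Qed.
Lemma ball0 (y : 'rV[R]_n) : dotp (y - 0) (y - 0) < r0 ^+ 2 -> L y.
Proof. by rewrite subr0; exact: L_ball. Qed.

Let near z x := Cc x /\
  forall y, Cc y -> dotp (x - z) (x - z) <= dotp (y - z) (y - z).

Lemma near_exists : exists f, forall z, near z (f z).
Proof.
suff /choice[f fP] : forall z, exists x, near z x by exists f.
move=> z; have [w [ww _ _]] := unit_orthogonal2 (0 : 'rV[R]_n) 0 n3.
have Co : Cc ((`|M| + 1) *: w).
  apply: subset_closure => /L_bounded; rewrite !(dotZl, dotZr) ww.
  rewrite -(real_normK (num_real M)); have := normr_ge0 M; nra.
have [x Cx xm] := nearest_point z (@closed_closure _ (~` L)) (ex_intro _ _ Co).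
by exists x.
Qed.

Lemma near_ball z x y : near z x ->
  dotp (y - z) (y - z) < dotp (x - z) (x - z) -> L y.
Proof.
by move=> [_ xm] h; apply: not_closure_setC => /xm; rewrite leNgt h.
Qed.

(** Otherwise [x] would lie strictly between [s *: x] in [L] and the ball about 0, hence in the
    interior. *)
Lemma scale_closure_setC x s : Cc x -> 1 < s -> ~ L (s *: x).
Proof.
move=> Cx s1 Lsx; have s0 : 0 < s by apply: lt_trans s1.
have h : 0 < 1 - s^-1 <= 1.
  by rewrite subr_gt0 invf_lt1 // s1 gerBl invr_ge0 ltW.
apply: (interior_between Lsx r0_gt0 ball0 h); suff -> : 
  (1 - (1 - s^-1)) *: (s *: x) + (1 - s^-1) *: 0 = x by [].
by rewrite scaler0 addr0 subKr scalerA mulVf ?scale1r ?gt_eqF.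
Qed.

Lemma closure_setC_neq0 x : Cc x -> x != 0.
Proof.
move=> Cx; apply/eqP => x0; apply: (@scale_closure_setC x 2 Cx); first by lra.
by rewrite x0 scaler0; exact: L_0.
Qed.

(** Otherwise a small move from [x], straight away from a suitable [g] near 0, would enter the open
    ball about [z], which lies in [L]; then [x] would lie between a point of [L] and the interior
    point [g]. *)
Lemma touch_pos z x : near z x -> x != z -> 0 < dotp (x - z) x.
Proof.
move=> nzx xz; rewrite ltNge; apply/negP => g0.
have nu0 : 0 < dotp (x - z) (x - z) by rewrite dot_gt0 subr_eq0.
have [nu nuX] : exists nu, x - z = nu by eexists.
have nb := @near_ball z x _ nzx; move: g0 nu0 nb; rewrite nuX => g0 nu0 nb.
have nuE : z = x - nu by rewrite -nuX; vec.
pose N := dotp nu nu; have N0 : 0 < N by [].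
(* Small enough for the ball of radius [r0 / 2] about [eta *: nu] to stay in [L]. *)
have [eta eta0 etaN] : exists2 eta, 0 < eta & eta ^+ 2 * N < r0 ^+ 2 / 4.
  exists (r0 / (4 * (N + 1)));
    first by rewrite divr_gt0 // mulr_gt0 // ltr_wpDl // ltW.
  rewrite expr_div_n mulrAC ltr_pdivrMr;
    last by rewrite exprn_gt0 // mulr_gt0 // ltr_wpDl // ltW.
  have := exprn_gt0 2 r0_gt0; move: (r0 ^+ 2) => q q0; nra.
have [g gE] : exists g, g = eta *: nu by eexists.
have [u uE] : exists u, u = x - g by eexists.
pose U := dotp u u; have U0 : 0 <= U by exact: dot_ge0.
have [th th0 hth] : exists2 th, 0 < th & th * U < 2 * (eta * N).
  exists ((eta * N) / (U + 1)); first by rewrite divr_gt0 ?mulr_gt0 // ltr_wpDl.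
  rewrite mulrAC ltr_pdivrMr ?ltr_wpDl //;
    have : 0 < eta * N by rewrite mulr_gt0.
  by move: (eta * N) => q q0; nra.
have Lx' : L (x + th *: u).
  apply: nb.
  have -> : x + th *: u - z = nu + th *: u by rewrite nuE; vec.
  rewrite dotDl !dotDr !(dotZl, dotZr) -/N -/U (dotC u).
  have : dotp nu u <= - (eta * N).
    by rewrite uE gE dotDr dotNr dotZr -/N lerBlDr; move: g0; lra.
  by nra.
have hs : 0 < th / (1 + th) <= 1.
  have h : 0 < 1 + th by rewrite addr_gt0.
  by rewrite divr_gt0 // ler_pdivrMr // mul1r lerDr ler01.
have r2 : 0 < r0 / 2 by rewrite divr_gt0.
have [] := interior_between Lx' r2 _ hs (g := g) => [y|].
  move=> d; apply: L_ball; have := dot_ge0 (y - 2 *: g).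
  move: d; rewrite !dotE (dotC g y).
  have -> : dotp g g = eta ^+ 2 * N by rewrite gE !(dotZl, dotZr) -/N; ring.
  move: (eta ^+ 2 * N) etaN (dotp y y) (dotp y g) => q1 h q2 q3.
  have -> : (r0 / 2) ^+ 2 = r0 ^+ 2 / 4 by field.
  by lra.
suff -> : (1 - th / (1 + th)) *: (x + th *: u) + (th / (1 + th)) *: g = x.
  by case: nzx.
rewrite uE; apply/rowP => ?; rewrite !mxE; field.
by rewrite gt_eqF // addr_gt0.
Qed.

(** [y] is the rescaled part of [p] orthogonal to [x]; if [p] is parallel to [x], any direction
    orthogonal to [x] and [m] serves. *)
Lemma perp_frame x m : x != 0 -> dotp x m = 0 -> dotp p m = 0 ->
  exists y p1 p2, [/\ dotp x y = 0, dotp y m = 0, dotp y y = dotp x x &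
    p = p1 *: x + p2 *: y].
Proof.
rewrite -dot_gt0 => X0 xm pm; pose p1 := dotp p x / dotp x x.
have XN : dotp x x != 0 by rewrite gt_eqF.
pose X := Num.sqrt (dotp x x); have X1 : 0 < X by rewrite sqrtr_gt0.
have XX : X ^+ 2 = dotp x x by rewrite sqr_sqrtr // ltW.
have [w0|w0] := eqVneq (p - p1 *: x) 0.
  have [y [yy yx ym]] := unit_orthogonal2 x m n3.
  exists (X *: y), p1, 0; rewrite !(dotZl, dotZr) yy dotC yx ym -XX.
  split; [ring|ring|ring|].
  by apply/eqP; rewrite scale0r addr0 -subr_eq0 w0.
pose w := p - p1 *: x; pose W := Num.sqrt (dotp w w).
have W0 : 0 < dotp w w by rewrite dot_gt0.
have W1 : 0 < W by rewrite sqrtr_gt0.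
have WW : W ^+ 2 = dotp w w by rewrite sqr_sqrtr // ltW.
have WN : W != 0 by rewrite gt_eqF.
have XN' : X != 0 by rewrite gt_eqF.
exists ((X / W) *: w), p1, (W / X); split.
- rewrite dotZr /w dotDr dotNr dotZr /p1 (dotC x p) divfK //; ring.
- by rewrite dotZl /w dotDl dotNl dotZl pm xm; ring.
- by rewrite !(dotZl, dotZr) -WW -XX; field.
- rewrite scalerA (_ : W / X * (X / W) = 1) ?scale1r; last by field;
  rewrite XN' WN.
  by rewrite /w addrC subrK.
Qed.

(** If [x - z] had a component along [m], tilting [x] to the proper side would give points of the
    open ball about [z], hence of [L], that end a chord too long for [chord_le]. *)
Lemma touch_orthogonal z x m : near z x -> x != z -> dotp m m = 1 ->
  dotp x m = 0 -> dotp p m = 0 -> dotp (x - z) m = 0.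
Proof.
move=> nzx xz mm xm pm; have g0 := touch_pos nzx xz; have [Cx _] := nzx.
have x0 := closure_setC_neq0 Cx.
have [y [p1 [p2 [xy ym yy pE]]]] := perp_frame x0 xm pm.
apply/eqP/negPn/negP => be0.
pose be := dotp (x - z) m; pose g := dotp (x - z) x; pose X := dotp x x.
have X0 : 0 < X by rewrite /X dot_gt0.
pose tau := be / g; have gN : g != 0 by rewrite gt_eqF.
have tau0 : tau != 0 by rewrite mulf_neq0 ?invr_eq0.
pose A := `|p1| + 1; pose W := A * `|tau| + 1.
have A0 : 0 <= A by rewrite addr_ge0.
have W0 : 0 <= W by rewrite addr_ge0 ?mulr_ge0.
pose C := (2 * W * `|be| + W ^+ 2 * X + (A + W) ^+ 2 + 1) / (2 * g).
have T0 : 0 <= 2 * W * `|be| + W ^+ 2 * X + (A + W) ^+ 2.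
  have := sqr_ge0 W; have := sqr_ge0 (A + W); have := normr_ge0 be; nra.
have C0 : 0 < C by rewrite divr_gt0 ?mulr_gt0 // ltr_wpDl.
have CE : 2 * C * g = 2 * W * `|be| + W ^+ 2 * X + (A + W) ^+ 2 + 1.
  by rewrite /C; field.
pose k := ((1 + C) * (1 + `|tau|))^-1.
have tp : 0 < `|tau| by rewrite normr_gt0.
have B0 : 0 < (1 + C) * (1 + `|tau|) by rewrite mulr_gt0 ?addr_gt0.
have k0 : 0 < k by rewrite invr_gt0.
have kE : k * ((1 + C) * (1 + `|tau|)) = 1 by rewrite mulVf ?gt_eqF.
have Ck : C * k < 1 by nra.
have ktau : k * `|tau| <= 1 by nra.
have Cktau : C * (k * `|tau|) <= 1 by nra.
(* The sign makes the first-order gain [- eps * tau] positive; [k] is small enough for it to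
   outweigh the loss [C * eps ^+ 2]. *)
pose eps := - tau * k.
have epsN : `|eps| = k * `|tau|
  by rewrite /eps normrM normrN (gtr0_norm k0) mulrC.
have eps0 : eps != 0 by rewrite mulf_neq0 ?oppr_eq0 // gt_eqF.
(* For [a = 1 - p1] this is one end of a chord of the tilted section, for [a = 1 + p1] the antipode
   of the other end. *)
have key a : `|a| <= A -> let sg := - a * eps * be / g - C * eps ^+ 2 in
    L ((1 + sg) *: x + ((a + sg) * eps) *: m).
  move=> aA sg; apply: (near_ball nzx).
  pose v := sg *: x + ((a + sg) * eps) *: m.
  have -> : (1 + sg) *: x + ((a + sg) * eps) *: m - z = (x - z) + v.
    by rewrite /v; vec.
  rewrite dot_sqrD -addrA gtrDl.
  have -> : dotp (x - z) v = sg * g + (a + sg) * eps * be.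
    by rewrite /v dotDr !dotZr.
  have -> : dotp v v = sg ^+ 2 * X + (a + sg) ^+ 2 * eps ^+ 2.
    by rewrite /v !(dotDl, dotDr, dotZl, dotZr) (dotC m) xm mm -/X; ring.
  rewrite addrA; apply: (@inward_step_lt0 _ g be X a eps C W) => //.
  - exact: ltW.
  - by rewrite epsN.
  - by rewrite epsN.
  - exact: ltW.
  - by rewrite -mulrA normrM -/tau lerD2r ler_wpM2r.
  - rewrite CE; have : (`|a| + W) ^+ 2 <= (A + W) ^+ 2.
      by have := normr_ge0 a; move: aA W0; nra.
    by lra.
pose sg1 := - (1 - p1) * eps * be / g - C * eps ^+ 2.
pose sg2 := - (1 + p1) * eps * be / g - C * eps ^+ 2.
have a1 : `|1 - p1| <= A by apply: le_trans (ler_normB _ _) _;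
  rewrite normr1 addrC.
have a2 : `|1 + p1| <= A by apply: le_trans (ler_normD _ _) _;
  rewrite normr1 addrC.
have LA : L (p1 *: x + (1 - p1 + sg1) *: (x + eps *: m)).
  by apply: (set_congr (key _ a1)); rewrite -/sg1; vec.
have LB : L (p1 *: x - (1 + p1 + sg2) *: (x + eps *: m)).
  by apply: (set_congr (L_sym (key _ a2))); rewrite -/sg2; vec.
have := chord_le xy xm ym yy X0 mm pE (fun s => scale_closure_setC Cx) LA LB.
have -> : 1 - p1 + sg1 + (1 + p1 + sg2) = 2 + 2 * (tau ^+ 2 * k * (1 - C * k)).
  by rewrite /sg1 /sg2 /eps /tau; field.
have : 0 < tau ^+ 2 * k * (1 - C * k).
  have t2 : 0 < tau ^+ 2 by rewrite lt_def sqrf_eq0 tau0 sqr_ge0.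
  by rewrite mulr_gt0 ?subr_gt0 //; exact: mulr_gt0.
have : 0 < eps ^+ 2 by rewrite lt_def sqrf_eq0 eps0 sqr_ge0.
rewrite -/X; move: (eps ^+ 2) (tau ^+ 2 * k * (1 - C * k)) => q1 q2 h1 h2.
by nra.
Qed.
Lemma near_span z x v : near z x -> dotp x v = 0 -> dotp p v = 0 -> dotp z v =
  0.
Proof.
move=> nzx xv pv; have [->//|v0] := eqVneq v 0; first by rewrite dot0r.
have [<-//|xz] := eqVneq x z.
have V0 : (Num.sqrt (dotp v v))^-1 != 0
  by rewrite invr_eq0 sqrtr_eq0 -ltNge dot_gt0.
have := touch_orthogonal nzx xz (dot_normalized v0).
rewrite !dotZr xv pv mulr0 => /(_ erefl erefl) /eqP.
by rewrite mulf_eq0 (negPf V0) dotDl dotNl xv sub0r oppr_eq0 => /eqP.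
Qed.

Lemma ray_closed z : (forall s, 0 <= s < 1 -> L (s *: z)) -> L z.
Proof.
move=> h; apply: L_closed => e e0.
pose k := e / (dotp z z + e + 1); have q0 := dot_ge0 z.
have D0 : 0 < dotp z z + e + 1 by lra.
have k0 : 0 < k by rewrite divr_gt0.
have kE : k * (dotp z z + e + 1) = e by rewrite divfK ?gt_eqF.
have k1 : k < 1 by nra.
exists ((1 - k) *: z); first by apply: h; lra.
have -> : (1 - k) *: z - z = - k *: z by vec.
rewrite !(dotZl, dotZr); move: (dotp z z) q0 D0 kE => q q0 D0 kE.
have : k * k <= k by nra.
nra.
Qed.

(** The squared distance from [z] to the complement when [f] selects nearest points. *)
Let gap (f : 'rV[R]_n -> 'rV[R]_n) z := dotp (f z - z) (f z - z).

(** * Invariance under rotations about the axis through [p] *)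

Section Rotation.
Variables (e : 'rV[R]_n) (t : R).
Hypotheses (ee : dotp e e = 1) (pE : p = t *: e).

(** By [near_span] every vector orthogonal to [e] and [x] is orthogonal to [w]; applied to the part
    of [w] orthogonal to [w'], this makes [w] and [w'] parallel. *)
Lemma near_collinear h w x : dotp e w = 0 -> w != 0 -> near (h *: e + w) x ->
  exists c l, x = c *: e + l *: w.
Proof.
move=> ew w0 nx; exists (dotp x e).
have [w' xE] : exists w', x = dotp x e *: e + w'.
  by exists (x - dotp x e *: e); vec.
have ew' : dotp e w' = 0.
  have := congr1 (dotp e) xE; rewrite dotDr dotZr ee (dotC x) => /eqP.
  by rewrite mulr1 -subr_eq0 opprD addNKr oppr_eq0 => /eqP.
have W0 : dotp w w != 0 by rewrite dot_eq0.
have [w'0|w'0] := eqVneq w' 0.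
  have xw : dotp x w = 0 by rewrite xE w'0 dotDl dotZl ew dot0l; ring.
  have := near_span nx xw; rewrite pE dotZl ew mulr0 dotDl dotZl ew mulr0 add0r.
  by move=> /(_ erefl) E; rewrite E eqxx in W0.
have W'0 : dotp w' w' != 0 by rewrite dot_eq0.
pose c := dotp w w' / dotp w' w'.
have [v vE] : exists v, v = w - c *: w' by eexists.
have ev : dotp e v = 0 by rewrite vE dotDr dotNr dotZr ew ew'; ring.
have w'v : dotp w' v = 0.
  by rewrite vE dotDr dotNr dotZr /c (dotC w' w) divfK // subrr.
have xv : dotp x v = 0 by rewrite xE dotDl dotZl ev w'v; ring.
have := near_span nx xv; rewrite pE dotZl ev mulr0 dotDl dotZl ev mulr0 add0r.
move=> /(_ erefl) wv; have : dotp v v == 0.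
  by rewrite {1}vE dotDl dotNl dotZl wv w'v mulr0 subrr.
rewrite dot_eq0 vE subr_eq0 => /eqP wE.
have c0 : c != 0 by apply: contraNneq w0 => c0; rewrite wE c0 scale0r.
by exists c^-1; rewrite wE scalerA mulVf // scale1r.
Qed.

(** The point [c e + l w1] nearest to [h e + w1] competes for [h e + w2]. As [|w1| = |w2|], its
    squared distance changes by exactly [l * |w2 - w1| ^ 2]. *)
Lemma dist_step (f : 'rV[R]_n -> 'rV[R]_n) h (w : 'rV[R]_n) : (forall z,
  near z (f z)) ->
  w != 0 -> exists C, forall w1 w2 : 'rV[R]_n,
  dotp e w1 = 0 -> dotp w1 w1 = dotp w w -> dotp e w2 = 0 -> dotp w2 w2 = dotp
    w w ->
  gap f (h *: e + w2) <= gap f (h *: e + w1) + C * dotp (w2 - w1) (w2 - w1).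
Proof.
move=> fP; rewrite -dot_gt0 => W0; have [Cq _] := fP 0; set q := f 0 in Cq.
pose B := 4 * dotp q q + 6 * (h ^+ 2 + dotp w w) + dotp w w.
(* An upper bound for [l], common to all [w1], from comparison with the fixed point [q]. *)
exists (B / (2 * dotp w w)) => w1 w2 ew1 w11 ew2 w22.
have w10 : w1 != 0 by rewrite -dot_gt0 w11.
have [Cx xm] := fP (h *: e + w1); have [_ ym] := fP (h *: e + w2).
have [c [l xE]] := near_collinear ew1 w10 (fP (h *: e + w1)).
apply: le_trans (ym _ Cx) _; have xq := xm _ Cq; rewrite /gap.
set x := f (h *: e + w1) in Cx xm xE xq *.
have z1 : dotp (h *: e + w1) (h *: e + w1) = h ^+ 2 + dotp w w.
  by rewrite !dotE ee w11 (dotC w1) ew1; ring.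
have -> : dotp (x - (h *: e + w2)) (x - (h *: e + w2)) =
   dotp (x - (h *: e + w1)) (x - (h *: e + w1)) + l * dotp (w2 - w1) (w2 - w1).
  by rewrite xE !dotE ee w11 w22 (dotC w1 e) (dotC w2 e) (dotC w2 w1) ew1 ew2;
    ring.
rewrite lerD2l ler_wpM2r ?dot_ge0 // ler_pdivlMr ?mulr_gt0 //.
have lE : l * dotp w w = dotp x w1 by rewrite xE !dotE ew1 w11; ring.
rewrite mulrCA lE /B.
by rewrite -z1 -w11; exact: dot_le_of_closer.
Qed.

(** Stereographic projection from [- w] gives a Lipschitz curve from [w] to [w2] on a circle; along
    it [gap] has a quadratic modulus and cannot grow. *)
Lemma dist_rotation f h (w w2 : 'rV[R]_n) : (forall z, near z (f z)) ->
  dotp e w = 0 -> dotp e w2 = 0 -> dotp w2 w2 = dotp w w -> w != 0 -> w2 != -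
    w ->
  gap f (h *: e + w2) <= gap f (h *: e + w).
Proof.
move=> fP ew ew2 w22 w0 w2N; have [C hC] := dist_step h fP w0.
have W0 : 0 < dotp w w by rewrite dot_gt0.
pose W := dotp w w; have WN : W != 0 by rewrite gt_eqF.
have [al alE] : exists al, dotp w w2 = al * W by exists (dotp w w2 / W);
  rewrite divfK.
have al1 : 0 < 1 + al.
  have : 0 < dotp (w2 + w) (w2 + w) by rewrite dot_gt0 addr_eq0.
  rewrite dot_sqrD w22 (dotC w2) -/W => h0.
  have : 0 < 2 * W * (1 + al).
    by rewrite (_ : _ * _ = W + 2 * dotp w w2 + W) // alE; ring.
  by rewrite pmulr_rgt0 // mulr_gt0.
have alN : 1 + al != 0 by rewrite gt_eqF.
(* Orthogonal to [w], and such that the line from [- w] in direction [w + k] meets the circle again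
   at [w2]. *)
have [k kE] : exists k, k = (1 + al)^-1 *: (w2 - al *: w) by eexists.
have ek : dotp e k = 0 by rewrite kE dotZr dotDr dotNr dotZr ew ew2; ring.
have wk : dotp w k = 0 by rewrite kE dotZr dotDr dotNr dotZr -/W alE; ring.
pose ka := dotp k k; have ka0 : 0 <= ka by exact: dot_ge0.
have kaE : W + ka = 2 * W / (1 + al).
  rewrite /ka kE !(dotZl, dotZr) dot_sqrD !(dotNl, dotNr, dotZl,
    dotZr) w22 (dotC w2) -/W.
  by rewrite alE; field.
have den s : 0 < W + s ^+ 2 * ka by rewrite ltr_pwDl // mulr_ge0 ?sqr_ge0.
have denN s : W + s ^+ 2 * ka != 0 by rewrite gt_eqF.
pose v s := (2 * W / (W + s ^+ 2 * ka)) *: (w + s *: k) - w.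
have ev s : dotp e (v s) = 0.
  by rewrite dotDr dotNr dotZr dotDr dotZr ew ek; ring.
have vv s : dotp (v s) (v s) = W.
  rewrite /v dot_sqrD !(dotNl, dotNr, dotZl, dotZr) dot_sqrD dotDl.
  rewrite !(dotZl, dotZr) (dotC k) wk -/W -/ka; field; exact: denN.
have vd s u : dotp (v s - v u) (v s - v u) <= 4 * ka * (s - u) ^+ 2.
  have -> : v s - v u = (2 * W / (W + s ^+ 2 * ka)) *: (w + s *: k)
      - (2 * W / (W + u ^+ 2 * ka)) *: (w + u *: k) by rewrite /v; vec.
  have -> : dotp ((2 * W / (W + s ^+ 2 * ka)) *: (w + s *: k)
      - (2 * W / (W + u ^+ 2 * ka)) *: (w + u *: k)) ((2 * W / (W + s ^+ 2 *
        ka)) *: (w + s *: k)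
      - (2 * W / (W + u ^+ 2 * ka)) *: (w + u *: k)) =
     4 * ka * (s - u) ^+ 2 * (W ^+ 2 / ((W + s ^+ 2 * ka) * (W + u ^+ 2 * ka))).
    rewrite !(dotDl, dotDr, dotNl, dotNr, dotZl, dotZr) (dotC k) wk -/W -/ka.
    by field; rewrite !denN.
  apply: ler_piMr; first by rewrite mulr_ge0 ?sqr_ge0 // mulr_ge0.
  rewrite ler_pdivrMr ?mul1r ?expr2; last by rewrite mulr_gt0 ?den.
  have sk q : 0 <= q ^+ 2 * ka by apply: mulr_ge0 => //; exact: sqr_ge0.
  by apply: ler_pM; rewrite ?lerDl ?sk // ltW.
have v1 : v 1 = w2.
  rewrite /v expr1n mul1r kaE kE; apply/rowP => ?; rewrite !mxE; field.
  by rewrite alN WN.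
have v0 : v 0 = w.
  by rewrite /v expr0n /= mul0r addr0; apply/rowP => ?; rewrite !mxE; field.
rewrite -v1 -[in leRHS]v0.
apply: (@quadratic_modulus_const _ (fun s =>
  gap f (h *: e + v s)) (`|C| * (4 * ka))) => s u.
apply: le_trans (hC (v s) (v u) (ev s) (vv s) (ev u) (vv u)) _.
rewrite lerD2l; apply: le_trans (ler_wpM2r (dot_ge0 _) (ler_norm C)) _.
by rewrite -mulrA ler_wpM2l.
Qed.

(** After shrinking towards 0 the given point has positive distance to the complement, hence so has
    the rotated one. The antipode, missed by the stereographic curve, is reached through a third
    direction. *)
Lemma rotation_sym h (w w2 : 'rV[R]_n) : dotp e w = 0 -> dotp e w2 = 0 ->
  dotp w2 w2 = dotp w w -> L (h *: e + w) -> L (h *: e + w2).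
Proof.
move=> ew ew2 w22 Lw; have [f fP] := near_exists.
have key u u2 : dotp e u = 0 -> dotp e u2 = 0 -> dotp u2 u2 = dotp u u ->
    u != 0 -> u2 != - u -> L (h *: e + u) -> L (h *: e + u2).
  move=> eu eu2 uu u0 uN Lu; apply: ray_closed => s /andP[s0 s1].
  have [->|sN] := eqVneq s 0; first by rewrite scale0r; exact: L_0.
  have sp : 0 < s by rewrite lt_def sN.
  have hs : 0 < 1 - s <= 1 by lra.
  have nC : ~ Cc ((s * h) *: e + s *: u).
    have := interior_between Lu r0_gt0 ball0 hs.
    by rewrite scaler0 addr0 subKr scalerDr scalerA.
  rewrite scalerDr scalerA; apply: not_closure_setC => C2; apply: nC.
  have := @dist_rotation f (s * h) (s *: u2) (s *: u) fP.
  rewrite !(dotZl, dotZr) eu eu2 !mulr0 uu => /(_ erefl erefl erefl).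
  have u20 : u2 != 0 by rewrite -dot_eq0 uu dot_eq0.
  rewrite scaler_eq0 (negPf sN) /= -scalerN (inj_eq (scalerI sN)).
  have uN2 : u != - u2 by apply: contraNneq uN => ->; rewrite opprK.
  move=> /(_ u20 uN2).
  set z := (s * h) *: e + s *: u; set z2 := (s * h) *: e + s *: u2.
  have [Cf _] := fP z; have [_ fm] := fP z2.
  have g2 : gap f z2 <= 0 by have := fm _ C2; rewrite subrr dot0l.
  move=> h1; have : gap f z <= 0 by exact: le_trans h1 g2.
  rewrite le_eqVlt ltNge dot_ge0 orbF dot_eq0 subr_eq0 => /eqP E.
  by rewrite -E.
have [w0|w0] := eqVneq w 0.
  by move: w22; rewrite w0 dot0l => /eqP; rewrite dot_eq0 => /eqP ->;
    rewrite -w0.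
have [w2N|] := eqVneq w2 (- w); last by move=> h2; exact: (key w).
have [w3 [w33 w3e w3w]] := unit_orthogonal2 e w n3.
have W0 : 0 < dotp w w by rewrite dot_gt0.
pose W := Num.sqrt (dotp w w).
have WW : W ^+ 2 = dotp w w by rewrite sqr_sqrtr // ltW.
have W1 : 0 < W by rewrite sqrtr_gt0.
have ew3 : dotp e (W *: w3) = 0 by rewrite dotZr dotC w3e mulr0.
have ww3 : dotp (W *: w3) (W *: w3) = dotp w w
  by rewrite !(dotZl, dotZr) w33 -WW; ring.
have ne (u : 'rV[R]_n) : dotp (W *: w3) u = 0 -> W *: w3 != u.
  move=> h0; apply: contraTneq W0 => E; rewrite -ww3 {2}E h0 ltxx //.
have L3 : L (h *: e + W *: w3).
  by apply: (key w) => //; apply: ne; rewrite dotNr dotZl w3w mulr0 oppr0.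
apply: (key (W *: w3)) => //.
- by rewrite ww3.
- by apply: ne; rewrite dot0r.
- by rewrite w2N eq_sym (inj_eq oppr_inj) ne // dotZl w3w mulr0.
Qed.

End Rotation.
Lemma ray_max x d : dotp d d = 1 -> L x -> exists s, [/\ 0 <= s,
  L (x + s *: d) & forall s', L (x + s' *: d) -> s' <= s].
Proof.
move=> dd Lx; pose S := [set s : R | L (x + s *: d)].
have S0 : S 0 by rewrite /S /= scale0r addr0.
have Sb : has_ubound S.
  exists (`|M| + `|dotp x d|) => s Ls; have := L_bounded Ls.
  rewrite dot_sqrD !(dotZl, dotZr) dd => h.
  have h1 : (s + dotp x d) ^+ 2 <= `|M| ^+ 2.
    rewrite real_normK ?num_real //; apply: le_trans h.
    have := dot_ge0 (x - dotp x d *: d).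
    by rewrite dot_sqrD !(dotNl, dotNr, dotZl, dotZr) dd; lra.
  have h2 : `|s + dotp x d| <= `|M|.
    by rewrite -(@ler_pXn2r _ 2) ?nnegrE // real_normK ?num_real.
  have := ler_norm (s + dotp x d); have := ler_norm (- dotp x d).
  by rewrite normrN; lra.
have hS : has_sup S by split; [exists 0|].
exists (sup S); split.
- exact: ub_le_sup.
- apply: L_closed => e e0; pose q := Num.min 1 e.
  have q0 : 0 < q by rewrite lt_min ltr01.
  have q1 : q <= 1 by rewrite ge_min lexx.
  have qe : q <= e by rewrite ge_min lexx orbT.
  have [s Ss hs] := sup_adherent q0 hS.
  have su : s <= sup S by exact: ub_le_sup.
  exists (x + s *: d) => //.
  have -> : x + s *: d - (x + sup S *: d) = (s - sup S) *: d by vec.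
  by rewrite !(dotZl, dotZr) dd; nra.
- by move=> s Ls; exact: ub_le_sup.
Qed.

(** * From a body of revolution to a ball *)

Section Revolution.
Variables (e v1 v : 'rV[R]_n) (t : R).
Hypotheses (ee : dotp e e = 1) (v11 : dotp v1 v1 = 1) (vv : dotp v v = 1).
Hypotheses (ev1 : dotp e v1 = 0) (ev : dotp e v = 0) (v1v : dotp v1 v = 0).
Hypotheses (t0 : 0 < t) (pE : p = t *: e).

Lemma revolution_profile : exists r g, [/\ 0 < r,
  forall h, `|h| <= r -> 0 <= g h &
  forall h w, dotp e w = 0 ->
    L (h *: e + w) <-> `|h| <= r /\ dotp w w <= g h ^+ 2].
Proof.
have [r [r_ge0 Lr rmax]] := ray_max ee L_0; rewrite !add0r in Lr.
have r_gt0 : 0 < r.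
  apply: (@lt_le_trans _ _ (r0 / 2)); first by rewrite divr_gt0.
  apply: rmax; rewrite add0r; apply: L_ball; rewrite !(dotZl, dotZr) ee.
  by have := exprn_gt0 2 r0_gt0; lra.
have Lh h : `|h| <= r -> L (h *: e).
  rewrite ler_norml => /andP[h1 h2].
  have hs : 0 <= (h + r) / (2 * r) <= 1.
    by rewrite divr_ge0 ?ler_pdivrMr /=; lra.
  apply: (set_congr (L_conv hs (L_sym Lr) Lr)).
  by apply/rowP => ?; rewrite !mxE; field; rewrite gt_eqF.
have hr h w : dotp e w = 0 -> L (h *: e + w) -> `|h| <= r.
  (* Averaging the point with its rotated copy at [- w] projects it to the axis. *)
  move=> ew Lw; have eNw : dotp e (- w) = 0 by rewrite dotNr ew oppr0.
  have Lw' : L (h *: e - w).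
    by apply: (rotation_sym ee pE ew eNw _ Lw); rewrite dotNl dotNr opprK.
  have half : 0 <= (2^-1 : R) <= 1 by lra.
  have Lhe : L (h *: e).
    apply: (set_congr (L_conv half Lw Lw')).
    by apply/rowP => ?; rewrite !mxE; field.
  rewrite ler_norml; apply/andP; split; last by apply: rmax; rewrite add0r.
  by rewrite lerNl; apply: rmax; rewrite add0r scaleNr; exact: L_sym.
(* The value 0 for [|h| > r] is a placeholder. *)
have /choice[g gP] : forall h, exists s, `|h| <= r -> [/\ 0 <= s,
    L (h *: e + s *: v1) & forall s', L (h *: e + s' *: v1) -> s' <= s].
  move=> h; case: (lerP `|h| r) => [/Lh/(ray_max v11)[s sP]|_];
    last by exists 0.
  by exists s.
exists r, g; split => // [h /gP[]//|h w ew].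
have W0 := dot_ge0 w; pose W := Num.sqrt (dotp w w).
have WW : W ^+ 2 = dotp w w by rewrite sqr_sqrtr.
have W1 : 0 <= W by exact: sqrtr_ge0.
have eW : dotp e (W *: v1) = 0 by rewrite dotZr ev1 mulr0.
have wW : dotp (W *: v1) (W *: v1) = dotp w w.
  by rewrite !(dotZl, dotZr) v11 -WW; ring.
split=> [Lw|[hh hw]].
  have hh := hr _ _ ew Lw; split => //.
  have [g0 _ gm] := gP _ hh.
  have := gm _ (rotation_sym ee pE ew eW wW Lw).
  by rewrite -WW => h1; rewrite lerXn2r ?nnegrE.
have [g0 Lg gm] := gP _ hh.
have Wg : W <= g h by rewrite -(@ler_pXn2r _ 2) ?nnegrE // WW.
apply: (rotation_sym ee pE eW ew (esym wW)).
have [g00|gN] := eqVneq (g h) 0.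
  have -> : W = 0 by lra.
  by rewrite scale0r addr0; exact: Lh.
have gp : 0 < g h by rewrite lt_def gN.
have hs : 0 <= W / g h <= 1 by rewrite divr_ge0 // ler_pdivrMr // mul1r.
apply: (set_congr (L_conv hs (Lh _ hh) Lg)).
by apply/rowP => ?; rewrite !mxE; field.
Qed.

Lemma revolution_ball : exists2 r, 0 < r & forall x, L x <-> dotp x x <= r ^+ 2.
Proof.
have [r [g [r_gt0 g_ge0 memL]]] := revolution_profile.
have mem1 h s : L (h *: e + s *: v1) <-> `|h| <= r /\ s ^+ 2 <= g h ^+ 2.
  by rewrite memL ?dotZr ?ev1 ?mulr0 // dotZl v11 mulr1 -expr2.
have le_g h s : `|h| <= r -> 0 <= s -> s ^+ 2 <= g h ^+ 2 -> s <= g h.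
  by move=> hh s0; rewrite ler_pXn2r ?nnegrE ?g_ge0.
have Lg h : `|h| <= r -> L (h *: e + g h *: v1) by move=> hh; apply/mem1.
have even h : `|h| <= r -> g h <= g (- h).
  move=> hh; have /L_sym L1 : L (h *: e + (- g h) *: v1).
    by apply/mem1; rewrite sqrrN.
  have /mem1[h2 h3] : L (- h *: e + g h *: v1) by apply: (set_congr L1); vec.
  exact: le_g (g_ge0 _ hh) h3.
have swap h : `|h| <= r -> g h <= r /\ `|h| <= g (g h).
  move=> hh; have pE1 : p = t *: e + 0 *: v1 by rewrite pE scale0r addr0.
  have := L_sym (section_center0 ee v11 ev1 pE1 (Lg _ hh)) => L1.
  have /mem1[h2 h3] : L (g h *: e + (- h) *: v1) by apply: (set_congr L1); vec.
  have gr : g h <= r by move: h2; rewrite ger0_norm ?g_ge0.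
  split => //; apply: le_g => //; move: h3;
    rewrite sqrrN real_normK ?num_real //.
have nr : `|r| <= r by rewrite ger0_norm // ltW.
have n0 : `|(0 : R)| <= r by rewrite normr0 ltW.
have circle : forall h, `|h| <= r -> g h ^+ 2 = r ^+ 2 - h ^+ 2.
  apply: (@profile_circle _ r t g r_gt0 t0 g_ge0).
  - move=> h hh; apply/eqP; rewrite eq_le even // andbT.
    by have := even (- h); rewrite normrN opprK; apply.
  - move=> h k s hh kk hs.
    have /mem1[h1 h2] : L (((1 - s) * h + s * k) *: e +
        ((1 - s) * g h + s * g k) *: v1).
      by apply: (set_congr (L_conv hs (Lg _ hh) (Lg _ kk))); vec.
    apply: le_g => //; have gh := g_ge0 _ hh; have gk := g_ge0 _ kk.
    by have /andP[s0 s1] := hs; rewrite addr_ge0 ?mulr_ge0 // subr_ge0.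
  - by move=> h /swap[].
  - by move=> h /swap[].
  - have [g0 _] := swap _ n0; apply/eqP; rewrite eq_le g0 /=.
    have pE1 : p = t *: e + 0 *: v1 by rewrite pE scale0r addr0.
    have L1 : L (r *: e + 0 *: v1).
      by apply/mem1; rewrite expr0n sqr_ge0.
    have /mem1[_ h3] : L (0 *: e + r *: v1).
      by apply: (set_congr (section_center0 ee v11 ev1 pE1 L1)); vec.
    by apply: le_g => //; exact: ltW.
  (* The section by the plane [p + span(d, v)], of slope [eps] to the axis. *)
  - move=> eps eps0; pose d := e + eps *: v1; pose D := Num.sqrt (1 + eps ^+ 2).
    have q0 : 0 < 1 + eps ^+ 2 by rewrite ltr_pwDl ?sqr_ge0.
    have DD : D ^+ 2 = 1 + eps ^+ 2 by rewrite sqr_sqrtr // ltW.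
    have D0 : D != 0 by rewrite gt_eqF // sqrtr_gt0.
    have aa : dotp (D^-1 *: d) (D^-1 *: d) = 1.
      rewrite !(dotZl, dotZr) /d dot_sqrD !(dotZl, dotZr) ee v11 ev1.
      have -> : 1 + 2 * (eps * 0) + eps * (eps * 1) = D ^+ 2 by rewrite DD;
        ring.
      by field.
    have ab : dotp (D^-1 *: d) v = 0.
      by rewrite dotZl /d dotDl dotZl ev v1v; ring.
    have [s0 [tv turn]] := L_turn aa vv ab.
    have flip s tau : L (p + s *: d + tau *: v) ->
        L (p + (2 * (s0 / D) - s) *: d + (2 * tv - tau) *: v).
      move=> Ls; have L1 : L (p + (s0 + (s * D - s0)) *: (D^-1 *: d) + (tv +
        (tau - tv)) *: v).
        by apply: (set_congr Ls); apply/rowP => ?; rewrite !mxE; field.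
      have L2 := turn _ _ L1.
      apply: (set_congr (turn _ _ L2)); apply/rowP => ?; rewrite !mxE; field;
        exact: D0.
    have memH s tau : L (p + s *: d + tau *: v) <->
        `|t + s| <= r /\ eps ^+ 2 * s ^+ 2 + tau ^+ 2 <= g (t + s) ^+ 2.
      have -> : p + s *: d + tau *: v = (t + s) *: e + ((s * eps) *: v1 + tau
        *: v).
        by rewrite pE /d; vec.
      rewrite memL; last by rewrite dotDr !dotZr ev1 ev; ring.
      rewrite dot_sqrD !(dotZl, dotZr) v11 vv v1v.
      suff -> : s * eps * (s * eps * 1) + 2 * (s * eps * (tau * 0)) + tau *
        (tau * 1)
        = eps ^+ 2 * s ^+ 2 + tau ^+ 2 by [].
      by ring.
    exists (t + s0 / D) => h hh hQ; set x := t + s0 / D.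
    (* Only an inequality; applied again at the image height it becomes the equality sought. *)
    have half k : `|k| <= r -> eps ^+ 2 * (k - t) ^+ 2 <= g k ^+ 2 ->
        `|2 * x - k| <= r /\ g k ^+ 2 - eps ^+ 2 * (k - t) ^+ 2 <=
          g (2 * x - k) ^+ 2 - eps ^+ 2 * (2 * x - k - t) ^+ 2.
      move=> kk kQ; pose Q := Num.sqrt (g k ^+ 2 - eps ^+ 2 * (k - t) ^+ 2).
      have QQ : Q ^+ 2 = g k ^+ 2 - eps ^+ 2 * (k - t) ^+ 2.
        by rewrite sqr_sqrtr // subr_ge0.
      have tk : t + (k - t) = k by ring.
      have LQ : L (p + (k - t) *: d + Q *: v).
        by apply/memH; rewrite tk QQ addrC subrK.
      have LQ' : L (p + (k - t) *: d + (- Q) *: v).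
        by apply/memH; rewrite tk sqrrN QQ addrC subrK.
      have xE : t + (2 * (s0 / D) - (k - t)) = 2 * x - k by rewrite /x; ring.
      have sE : 2 * (s0 / D) - (k - t) = 2 * x - k - t by rewrite /x; ring.
      have /memH := flip _ _ LQ; rewrite xE sE => -[r1 h1].
      have /memH := flip _ _ LQ'; rewrite xE sE => -[_ h2].
      (* The chord ends at [Q] and [- Q] go to [2 * tv - Q] and [2 * tv + Q], the mean of whose
         squares is at least [Q ^+ 2]. *)
      by split => //; have := sqr_ge0 tv; lra.
    have [h1 h2] := half _ hh hQ; split => //.
    have hQ' : eps ^+ 2 * (2 * x - h - t) ^+ 2 <= g (2 * x - h) ^+ 2 by lra.
    have [_] := half _ h1 hQ'; rewrite (_ : 2 * x - (2 * x - h) = h);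
      last by ring.
    by lra.
exists r => // x; have [w xE] : exists w, x = dotp e x *: e + w.
  by exists (x - dotp e x *: e); vec.
have ew : dotp e w = 0.
  have := congr1 (dotp e) xE; rewrite dotDr dotZr ee => /eqP.
  by rewrite mulr1 -subr_eq0 opprD addNKr oppr_eq0 => /eqP.
move: (dotp e x) xE => h ->; rewrite memL //.
have -> : dotp (h *: e + w) (h *: e + w) = h ^+ 2 + dotp w w.
  by rewrite dot_sqrD !(dotZl, dotZr) ee ew; ring.
have W0 := dot_ge0 w.
split=> [[hh]|hx]; first by rewrite circle //; lra.
have hh : `|h| <= r.
  by rewrite -(@ler_pXn2r _ 2) ?nnegrE ?(ltW r_gt0) // real_normK ?num_real
    //; lra.
by split => //; rewrite circle //; lra.
Qed.

End Revolution.

Lemma symmetric_body_ball : exists2 r, 0 < r & forall x,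
  L x <-> dotp x x <= r ^+ 2.
Proof.
have [p0|p0] := eqVneq p 0; last first.
  pose t := Num.sqrt (dotp p p); have t0 : 0 < t by rewrite sqrtr_gt0 dot_gt0.
  have ee := dot_normalized p0; set e := _ *: p in ee.
  have [v1 [v11 v1e _]] := unit_orthogonal2 e e n3.
  have [v [vv ve vv1]] := unit_orthogonal2 e v1 n3.
  apply: (@revolution_ball e v1 v t) => //; rewrite 1?dotC //.
  by rewrite /e -/t scalerA mulfV ?scale1r // gt_eqF.
have pE (a b : 'rV[R]_n) : p = 0 *: a + 0 *: b by rewrite p0 !scale0r addr0.
(* Two quarter turns about 0, through a direction orthogonal to both [a] and [b]. *)
have move_unit a b s : dotp a a = 1 -> dotp b b = 1 -> L (s *: a) -> L (s *: b).
  move=> aa bb La; have [z [zz za zb]] := unit_orthogonal2 a b n3.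
  have az : dotp a z = 0 by rewrite dotC.
  have Lz : L (s *: z).
    have La' : L (s *: a + 0 *: z) by rewrite scale0r addr0.
    by apply: (set_congr (section_center0 aa zz az (pE _ _) La')); vec.
  have Lz' : L (s *: z + 0 *: b) by rewrite scale0r addr0.
  by apply: (set_congr (section_center0 zz bb zb (pE _ _) Lz')); vec.
have [a [aa _ _]] := unit_orthogonal2 (0 : 'rV[R]_n) 0 n3.
have [r [r_ge0 Lr rmax]] := ray_max aa L_0; rewrite !add0r in Lr.
have r_gt0 : 0 < r.
  apply: (@lt_le_trans _ _ (r0 / 2)); first by rewrite divr_gt0.
  apply: rmax; rewrite add0r; apply: L_ball; rewrite !(dotZl, dotZr) aa.
  by have := exprn_gt0 2 r0_gt0; lra.
exists r => // x; have [->|x0] := eqVneq x 0.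
  by rewrite dot0l; split=> _; [exact: sqr_ge0|exact: L_0].
have uu := dot_normalized x0; set X := Num.sqrt _ in uu *.
have X0 : 0 < X by rewrite sqrtr_gt0 dot_gt0.
have XX : X ^+ 2 = dotp x x by rewrite sqr_sqrtr ?dot_ge0.
have xE : x = X *: (X^-1 *: x) by rewrite scalerA mulfV ?scale1r // gt_eqF.
rewrite -XX; split=> [Lx|hX].
  have XR : X <= r by apply: rmax; rewrite add0r;
    apply: (move_unit _ _ _ uu aa); rewrite -xE.
  by rewrite lerXn2r ?nnegrE // ltW.
have XR : X <= r by rewrite -(@ler_pXn2r _ 2) ?nnegrE // ltW.
have hs : 0 <= X / r <= 1 by rewrite divr_ge0 ?(ltW X0) // ler_pdivrMr // mul1r.
rewrite xE; apply: (move_unit _ _ _ aa uu);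
  apply: (set_congr (L_conv hs L_0 Lr)).
by apply/rowP => ?; rewrite !mxE; field; rewrite gt_eqF.
Qed.
End SymmetricBody.

(** * Existence of a center of symmetry *)

Section PlaneSections.
Context (R : realType) (n : nat).
Implicit Types (a b c x y : 'rV[R]_n) (K : set 'rV[R]_n).

Lemma span2P a b x :
  reflect (exists s t, x = s *: a + t *: b) (x \in <<[:: a; b]>>%VS).
Proof.
rewrite span_cons span_seq1; apply: (iffP memv_addP).
  by move=> [u /vlineP[s ->] [v /vlineP[t ->] ->]]; exists s, t.
move=> [s [t ->]]; exists (s *: a); first by rewrite memvZ ?memv_line.
by exists (t *: b); rewrite ?memvZ ?memv_line.
Qed.

Lemma dim_span2 a b : dotp a a = 1 -> dotp b b = 1 -> dotp a b = 0 ->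
  \dim <<[:: a; b]>>%VS = 2.
Proof.
move=> aa bb ab; apply/eqP; rewrite -[2%N]/(size [:: a; b]).
rewrite -/(free [:: a; b]) free_cons span_seq1 seq1_free.
have b0 : b != 0 by rewrite -dot_gt0 bb.
rewrite b0 andbT; apply/negP => /vlineP[k ak].
by have := ab; rewrite ak dotZl bb mulr1 => k0; move: aa;
  rewrite ak k0 scale0r dot0l; lra.
Qed.

Lemma cube_in_plane (H : {vspace 'rV[R]_n}) Q : \dim H = 2 -> cube_in H Q ->
  exists c e1 e2 r, [/\ c \in H, e1 \in H /\ e2 \in H,
    [/\ dotp e1 e1 = 1, dotp e2 e2 = 1 & dotp e1 e2 = 0] &
    Q = [set x | exists s t, [/\ `|s| <= r, `|t| <= r &
      x = c + (s *: e1 + t *: e2)]]].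
Proof.
move=> dH [c [e [r [cH eH eo r0 ->]]]].
move: e eH eo; rewrite dH => e eH eo.
exists c, (e ord0), (e (lift ord0 ord0)), r; split=> //.
apply/seteqP; split=> x /=.
  move=> [t [ht ->]]; exists (t ord0), (t (lift ord0 ord0)); split => //.
  by rewrite !big_ord_recl big_ord0 addr0.
move=> [s [t [hs ht ->]]]; exists (fun i => if i == ord0 then s else t); split.
  by move=> i; case: ifP.
by rewrite !big_ord_recl big_ord0 addr0.
Qed.

(** A cube in a plane is a square, and the quarter turn about its center is one of its
    symmetries. *)
Lemma one_symmetric_quarter_turn K (n3 : (3 <= n)%N) :
  (forall H : {vspace 'rV[R]_n},
    (1 <= \dim H <= n.-1)%N -> one_symmetric H (K `&` [set` H])) ->
  quarter_turn_sections K 0.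
Proof.
move=> hsym a b aa bb ab; pose H := <<[:: a; b]>>%VS.
have dH : \dim H = 2 := dim_span2 aa bb ab.
have [|Q [/(cube_in_plane dH)]] := hsym H;
  first by rewrite dH /= -ltnS (ltn_predK n3).
move=> [c [e1 [e2 [r [cH [e1H e2H] [e11 e22 e12] ->]]]]] sub.
have /span2P[s0 [t0 cE]] := cH.
have /span2P[al [be e1E]] := e1H.
have /span2P[ga [de e2E]] := e2H.
have ba : dotp b a = 0 by rewrite dotC.
have n1 : al ^+ 2 + be ^+ 2 = 1.
  by rewrite -e11 e1E !dotE aa bb ab ba; ring.
have n2 : ga ^+ 2 + de ^+ 2 = 1.
  by rewrite -e22 e2E !dotE aa bb ab ba; ring.
have o12 : al * ga + be * de = 0.
  by rewrite -e12 e1E e2E !dotE aa bb ab ba; ring.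
(* The determinant of [(e1, e2)] relative to [(a, b)], equal to 1 or -1. *)
have [q qE] : exists q, q = al * de - be * ga by eexists.
have q2 : q ^+ 2 = 1.
  have -> : q ^+ 2 = (al ^+ 2 + be ^+ 2) * (ga ^+ 2 + de ^+ 2) - (al * ga + be
    * de) ^+ 2.
    by rewrite qE; ring.
  by rewrite n1 n2 o12; ring.
have alE : al = q * de.
  apply/eqP; rewrite -subr_eq0; apply/eqP.
  have -> : al - q * de = al * (1 - (ga ^+ 2 + de ^+ 2)) + ga * (al * ga + be
    * de).
    by rewrite qE; ring.
  by rewrite n2 o12; ring.
have gaE : ga = - (q * be).
  apply/eqP; rewrite -subr_eq0; apply/eqP.
  have -> : ga - - (q * be) = ga * (1 - (al ^+ 2 + be ^+ 2)) + al * (al * ga +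
    be * de).
    by rewrite qE; ring.
  by rewrite n1 o12; ring.
have bd : be ^+ 2 + de ^+ 2 = 1 by rewrite -n1 alE exprMn q2; ring.
have {}e1E : e1 = (q * de) *: a + be *: b by rewrite -alE.
have {}e2E : e2 = (- (q * be)) *: a + de *: b by rewrite -gaE.
pose T x := c + ((- dotp (x - c) e2) *: e1 + dotp (x - c) e1 *: e2).
have Hab u : u \in H -> exists s t, u = s *: a + t *: b by move/span2P.
have Te u : T (c + u) = c + ((- dotp u e2) *: e1 + dotp u e1 *: e2).
  by rewrite /T (_ : c + u - c = u) //; vec.
have TE s t : T (c + (s *: a + t *: b)) = c + ((- (q * t)) *: a + (q * s) *: b).
  have d1 : dotp (s *: a + t *: b) e1 = s * (q * de) + t * be.
    by rewrite e1E !dotE aa bb ab ba; ring.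
  have d2 : dotp (s *: a + t *: b) e2 = - (s * (q * be)) + t * de.
    by rewrite e2E !dotE aa bb ab ba; ring.
  rewrite Te d1 d2 e1E e2E; congr (_ + _).
  have -> : - (q * t) = - (q * t) * (be ^+ 2 + de ^+ 2) by rewrite bd mulr1.
  have -> : q * s = s * q * (be ^+ 2 + de ^+ 2) by rewrite bd mulr1 mulrC.
  by apply/rowP => ?; rewrite !mxE; ring: q2.
have Tc u : u \in H -> exists s t, u = c + (s *: a + t *: b).
  move=> uH; have /Hab[s [t E]] : u - c \in H by rewrite memvB.
  by exists s, t; rewrite -E; vec.
have memH s t : c + (s *: a + t *: b) \in H.
  by rewrite memvD //; apply/span2P; exists s, t.
have isoT : isometry_on H T.
  split; last first.
    move=> x y /Tc[s [t ->]] /Tc[s' [t' ->]]; rewrite /edist /enorm !TE.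
    congr (Num.sqrt _).
    have -> : c + (- (q * t) *: a + (q * s) *: b) - (c + (- (q * t') *: a + (q
      * s') *: b))
      = (- (q * (t - t'))) *: a + (q * (s - s')) *: b by vec.
    have -> : c + (s *: a + t *: b) - (c + (s' *: a + t' *: b)) =
      (s - s') *: a + (t - t') *: b by vec.
    have dd (u v : R) : dotp (u *: a + v *: b) (u *: a + v *: b) = u ^+ 2 + v
      ^+ 2.
      by rewrite !dotE aa bb ab ba; ring.
    by rewrite !dd sqrrN !exprMn q2; ring.
  split.
  - by move=> x /= /Tc[s [t ->]]; rewrite TE; exact: memH.
  - move=> x y; rewrite !inE /= => /Tc[s [t ->]] /Tc[s' [t' ->]];
    rewrite !TE => /addrI E.
    have q0 : q != 0 by apply/eqP => q0; move: q2; rewrite q0; lra.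
    have := congr1 (dotp a) E;
      rewrite !dotE aa ab !mulr1 !mulr0 !addr0 => /oppr_inj/(mulfI q0) ->.
    by have := congr1 (dotp b) E;
      rewrite !dotE ba bb !mulr1 !mulr0 !add0r => /(mulfI q0) ->.
  - move=> y /= /Tc[s [t ->]];
    exists (c + ((q * t) *: a + (- (q * s)) *: b)); first exact: memH.
    rewrite TE; congr (_ + (_ *: _ + _ *: _)).
      by rewrite mulrN opprK mulrA -expr2 q2 mul1r.
    by rewrite mulrA -expr2 q2 mul1r.
have orth (s t : R) : dotp (s *: e1 + t *: e2) e1 = s /\ dotp (s *: e1 + t *:
  e2) e2 = t.
  by rewrite !dotE e11 e22 e12 (dotC e2) e12; split; ring.
set Q0 := [set x | _] in sub.
have TQ : T @` Q0 = Q0.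
  apply/seteqP; split=> x.
    move=> [y [s [t [hs ht ->]]] <-]; rewrite Te.
    have [-> ->] := orth s t; exists (- t), s.
    by rewrite normrN.
  move=> [s [t [hs ht ->]]]; exists (c + (t *: e1 + (- s) *: e2)).
    by exists t, (- s); rewrite normrN.
  by rewrite Te; have [-> ->] := orth t (- s); rewrite opprK.
have [_ TK] := sub T (conj isoT TQ).
have Tmem s t : K (c + (s *: a + t *: b)) -> K (c + ((- (q * t)) *: a + (q *
  s) *: b)).
  move=> Ks; rewrite -TE; suff [] :
    (K `&` [set` H]) (T (c + (s *: a + t *: b))) by [].
  by rewrite -TK; exists (c + (s *: a + t *: b)) => //; split => //=;
    exact: memH.
exists s0, t0 => s t Ks.
have Ks' : K (c + (s *: a + t *: b)) by rewrite cE; apply: (set_congr Ks); vec.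
suff K' : K (c + (- t *: a + s *: b)) by apply: (set_congr K'); rewrite cE; vec.
have : q = 1 \/ q = -1.
  have /eqP : (q - 1) * (q + 1) = 0 by rewrite -subr_sqr q2 expr1n subrr.
  by rewrite mulf_eq0 subr_eq0 addr_eq0 => /orP[] /eqP; [left|right].
case=> q1; first by apply: (set_congr (Tmem _ _ Ks')); rewrite q1; vec.
(* For opposite orientations the third power of the turn is the one wanted. *)
by apply: (set_congr (Tmem _ _ (Tmem _ _ (Tmem _ _ Ks')))); rewrite q1; vec.
Qed.

End PlaneSections.

(** * Strips of maximal ratio *)

Section CentralSymmetry.
Context (R : realType) (n : nat).
Variable (K : set 'rV[R]_n).
Hypothesis n3 : (3 <= n)%N.
Hypothesis K_compact : compact K.
Hypothesis K_conv : forall x y s,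
  0 <= s <= 1 -> K x -> K y -> K ((1 - s) *: x + s *: y).
Variables (z0 : 'rV[R]_n) (r0 : R).
Hypothesis r0_gt0 : 0 < r0.
Hypothesis K_ball : forall y, dotp (y - z0) (y - z0) < r0 ^+ 2 -> K y.
Hypothesis K_turn : quarter_turn_sections K 0.

Lemma K_closed x :
  (forall e, 0 < e -> exists2 y, K y & dotp (y - x) (y - x) < e) -> K x.
Proof.
apply: closed_dotP; apply: compact_closed => //; exact: norm_hausdorff.
Qed.

Lemma K_z0 : K z0.
Proof. by apply: K_ball; rewrite subrr dot0l exprn_gt0. Qed.

(** [u] is the point of least norm in the compact convex set [K - k B], which misses 0. *)
Lemma separate_scaled (B : set 'rV[R]_n) k : compact B ->
  (forall x y s, 0 <= s <= 1 -> B x -> B y -> B ((1 - s) *: x + s *: y)) ->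
  B !=set0 -> (forall x, B x -> ~ K (k *: x)) ->
  exists u, exists2 d, 0 < d & forall x z, B x -> K z ->
    k * dotp u x + d <= dotp u z.
Proof.
move=> kB cB [b0 Bb0] disj.
pose f (w : 'rV[R]_n * 'rV[R]_n) := w.1 - k *: w.2.
have cf : continuous f.
  move=> w; apply: (@continuousB R _ _ (fun w => w.1) (fun w => k *: w.2) w).
    exact: cvg_fst.
  by apply: continuousZr; exact: cvg_snd.
pose D := f @` (K `*` B).
have kD : compact D.
  apply: continuous_compact; first exact: continuous_subspaceT.
  exact: compact_setX.
have cD : closed D by apply: compact_closed => //; exact: norm_hausdorff.
have [|u Du um] := nearest_point 0 cD.
  by exists (f (z0, b0)); exists (z0, b0) => //; split => //=; exact: K_z0.
exists u, (dotp u u).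
  rewrite dot_gt0; apply/eqP => u0; move: Du; rewrite u0 => -[[z x] [/= Kz Bx]].
  by rewrite /f /= => /eqP; rewrite subr_eq0 => /eqP zx; apply: (disj x Bx);
    rewrite -zx.
have key v : D v -> dotp u u <= dotp u v.
  move=> Dv; suff : dotp (0 - u) (v - u) <= 0.
    by rewrite sub0r dotNl dotDr dotNr; lra.
  apply: nearest_obtuse => s hs; apply: um.
  have -> : u + s *: (v - u) = (1 - s) *: u + s *: v by vec.
  move: Du Dv => [[z1 x1] [/= Kz1 Bx1] <-] [[z2 x2] [/= Kz2 Bx2] <-].
  exists ((1 - s) *: z1 + s *: z2, (1 - s) *: x1 + s *: x2).
    by split => /=; [exact: K_conv|exact: cB].
  by rewrite /f /=; vec.
move=> x z Bx Kz; have /key : D (f (z, x)) by exists (z, x).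
by rewrite /f /= dotDr dotNr dotZr; lra.
Qed.

Lemma K_nonflat N : N != 0 -> exists z1 z2, [/\ K z1,
  K z2 & dotp N z1 < dotp N z2].
Proof.
rewrite -dot_gt0 => N0.
pose q := r0 / (2 * (dotp N N + 1)).
have D0 : 0 < dotp N N + 1 by rewrite addr_gt0.
have q0 : 0 < q by rewrite divr_gt0 ?mulr_gt0.
have qE : 2 * q * (dotp N N + 1) = r0 by rewrite /q; field; rewrite gt_eqF.
have hq : q * q * dotp N N < r0 ^+ 2.
  by rewrite -qE; move: (dotp N N) N0 => c c0; nra.
exists (z0 - q *: N), (z0 + q *: N); split.
- apply: K_ball; rewrite (_ : _ - _ = - q *: N); last by vec.
  by rewrite !(dotZl, dotZr) !mulNr mulrN opprK mulrA.
- apply: K_ball; rewrite (_ : _ - _ = q *: N); last by vec.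
  by rewrite !(dotZl, dotZr) mulrA.
have h : 0 < q * dotp N N by rewrite mulr_gt0.
by rewrite !dotDr dotNr dotZr; lra.
Qed.

(** The upper side is encoded by a point [x] of [K] on it, so that strips become triples in a
    compact set. *)
Let strip q N x := K x /\
  forall x', K x' -> q * dotp N x <= dotp N x' <= dotp N x.

Lemma extremal_strip : exists q N x, [/\ dotp N N = 1, strip q N x,
  -1 <= q <= 1 &
  forall q' N' x', N' != 0 -> strip q' N' x' -> q' <= 1 -> q' <= q].
Proof.
pose V := 'rV[R]_n; pose T : topologicalType := (V * V * R)%type.
have cN : continuous (fun w : T => w.1.1).
  by move=> w; apply: continuous_comp; [exact: cvg_fst|exact: cvg_fst].
have cx : continuous (fun w : T => w.1.2).
  by move=> w; apply: continuous_comp; [exact: cvg_fst|exact: cvg_snd].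
have cq : continuous (fun w : T => w.2) by move=> w; exact: cvg_snd.
pose sphere : set V := [set N | dotp N N = 1].
have c_id : continuous (@id V) by move=> x; exact: cvg_id.
have kS : compact sphere.
  apply: (@dot_bounded_compact _ _ _ 1) => [|x /= ->] //.
  apply: (@preimage_closed _ _ (fun N : V => dotp N N) [set y | y = 1]);
    last exact: closed_eq.
  by move=> w _; exact: (continuous_dot c_id c_id).
pose A : set T := (sphere `*` K) `*` `[-1, 1]%classic.
have kA : compact A.
  apply: compact_setX; last exact: segment_compact.
  exact: compact_setX.
pose F (x' : V) : set T := [set w | w.2 * dotp w.1.1 w.1.2 <= dotp w.1.1 x'] `&`
   [set w | dotp w.1.1 x' <= dotp w.1.1 w.1.2].
pose S : set T := A `&` \bigcap_(x' in K) F x'.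
have cdot (y : V) : continuous (fun w : T => dotp w.1.1 y).
  by apply: continuous_dot => //; exact: cst_continuous.
have cdotx : continuous (fun w : T => dotp w.1.1 w.1.2)
  by exact: continuous_dot.
have cS : compact S.
  apply: compact_closedI => //; apply: closed_bigI => y Ky; apply: closedI.
    have -> : [set w : T | w.2 * dotp w.1.1 w.1.2 <= dotp w.1.1 y] =
       (fun w : T => w.2 * dotp w.1.1 w.1.2 - dotp w.1.1 y) @^-1` [set s | s
         <= 0].
      by apply/seteqP; split=> w /=; rewrite subr_le0.
    apply: preimage_closed; last exact: closed_le.
    move=> w _; apply: (@continuousB R _ _ (fun w : T => w.2 * dotp w.1.1 w.1.2)
        (fun w : T => dotp w.1.1 y)); last exact: cdot.
    by apply: continuousM; [exact: cq|exact: cdotx].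
  have -> : [set w : T | dotp w.1.1 y <= dotp w.1.1 w.1.2] =
     (fun w : T => dotp w.1.1 y - dotp w.1.1 w.1.2) @^-1` [set s | s <= 0].
    by apply/seteqP; split=> w /=; rewrite subr_le0.
  apply: preimage_closed; last exact: closed_le.
  move=> w _; apply: (@continuousB R _ _ (fun w : T => dotp w.1.1 y)
      (fun w : T => dotp w.1.1 w.1.2)); [exact: cdot|exact: cdotx].
have SP N x q : S ((N, x), q) <-> [/\ dotp N N = 1, strip q N x & -1 <= q <= 1].
  split.
    move=> [[[/= NN Kx] /=]]; rewrite in_itv /= => hq hF; split => //;
      split => // y Ky.
    by have [/= -> ->] := hF y Ky.
  move=> [NN [Kx hx] hq]; split; first by split => //=; rewrite in_itv.
  by move=> y /hx /andP[].
have K0 : K !=set0 by exists z0; exact: K_z0.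
have S0 : S !=set0.
  have [N [NN _ _]] := unit_orthogonal2 (0 : V) 0 n3.
  have [x Kx xm] := linear_max N K_compact K0.
  have [y Ky ym] := linear_max (- N) K_compact K0.
  have ym' z : K z -> dotp N y <= dotp N z by move=> /ym; rewrite !dotNl lerN2.
  (* Orienting the normal towards the supporting side farther out gives a strip of ratio -1. *)
  case: (lerP (- dotp N y) (dotp N x)) => h.
    exists ((N, x), -1); apply/SP; split; [by []| |by rewrite lexx; lra].
    by split => // z Kz; rewrite xm // andbT; have := ym' _ Kz; lra.
  exists ((- N, y), -1); apply/SP; split;
    [by rewrite dotNl dotNr opprK| |by rewrite lexx; lra].
  by split => // z Kz; rewrite ym // andbT !dotNl; have := xm _ Kz; lra.
have [[[N x] q] /set_mem/SP[NN sq q1] qmax] :=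
  compact_EVT_max S0 cS (continuous_subspaceT cq).
exists q, N, x; split => // q' N' x' N0 [Kx' hx'] q'1.
case: (lerP (-1) q') => hq'; last by have /andP[] := q1; lra.
have /mem_set /qmax : S (((Num.sqrt (dotp N' N'))^-1 *: N', x'), q').
  apply/SP; split; [exact: dot_normalized| |by rewrite hq'].
  split => // y /hx' /andP[h1 h2].
  by rewrite !dotZl mulrCA !ler_wpM2l // ?invr_ge0 ?sqrtr_ge0.
by [].
Qed.

(** * Opposite faces of the extremal strip *)

Section ExtremalStrip.
Variables (k : R) (N x0 : 'rV[R]_n).
Hypotheses (NN : dotp N N = 1) (k_strip : strip k N x0) (k_itv : -1 <= k <= 1).
Hypothesis k_max : forall q' N' x',
  N' != 0 -> strip q' N' x' -> q' <= 1 -> q' <= k.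

Let be := dotp N x0.

Lemma strip_bounds x : K x -> k * be <= dotp N x <= be.
Proof. by move=> Kx; have [_ /(_ _ Kx)] := k_strip. Qed.

Lemma strip_pos : k < 1 /\ 0 < be.
Proof.
have N0 : N != 0 by rewrite -dot_gt0 NN.
have /andP[_ k1] := k_itv.
have [z1 [z2 [K1 K2 lt12]]] := K_nonflat N0.
have /andP[h1 h2] := strip_bounds K1; have /andP[h3 h4] := strip_bounds K2.
have h : 0 < (1 - k) * be by lra.
have k2 : k < 1.
  by rewrite lt_neqAle k1 andbT; apply: contraTneq h => ->;
    rewrite subrr mul0r ltxx.
by split => //; move: h; rewrite pmulr_rgt0 // subr_gt0.
Qed.

Lemma linear_extrema u : u != 0 -> exists xa xb, [/\ K xa, K xb,
  forall z, K z -> dotp u xa <= dotp u z <= dotp u xb & dotp u xa < dotp u xb].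
Proof.
move=> u0; have K0 : K !=set0 by exists z0; exact: K_z0.
have [xb Kb xbm] := linear_max u K_compact K0.
have [xa Ka xam] := linear_max (- u) K_compact K0.
exists xa, xb; split => // [z Kz|].
  by rewrite xbm // andbT; have := xam _ Kz; rewrite !dotNl lerN2.
have [z1 [z2 [K1 K2 lt12]]] := K_nonflat u0.
by have := xbm _ K2; have := xam _ K1; rewrite !dotNl; lra.
Qed.

Lemma strip_ratio u a b x : u != 0 -> K x -> dotp u x = b -> 0 < b -> a <= b ->
  (forall z, K z -> a <= dotp u z <= b) -> a <= k * b.
Proof.
move=> u0 Kx <- b0 ab h; have : a / dotp u x <= k.
  apply: (k_max u0 (x' := x)); last by rewrite ler_pdivrMr // mul1r.
  by split => // z /h; rewrite divfK ?gt_eqF.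
by rewrite ler_pdivrMr.
Qed.

(** If [u] separated [k *: x] from [K], the strip with normal [u] or [- u] would contradict the
    maximality of [k]. *)
Lemma K_scale x : k <= 0 -> K x -> K (k *: x).
Proof.
move=> k0 Kx; apply: contrapT => nK; pose B : set 'rV[R]_n := [set x].
have [|||_ ->|u [d d0 sep]] := @separate_scaled B k => //.
- exact: compact_set1.
- by move=> y z s _ -> ->; rewrite /B /=; vec.
- by exists x.
have {}sep z : K z -> k * dotp u x + d <= dotp u z by apply: sep.
have u0 : u != 0.
  by apply/eqP => u0; have := sep _ Kx; rewrite u0 !dot0l; lra.
have [xa [xb [Ka Kb hab ltab]]] := linear_extrema u0.
have /andP[h1 h2] := hab _ Kx; have ha := sep _ Ka.
case: (ltrP 0 (dotp u xb)) => hb.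
  have := strip_ratio u0 Kb erefl hb (ltW ltab) hab.
  have : k * dotp u xb <= k * dotp u x by rewrite ler_wnM2l.
  by lra.
(* Here [u <= 0] on [K]: the strip with normal [- u] has a nonnegative ratio, which leaves only
   [k = 0], where the separation itself fails. *)
have Nu0 : - u != 0 by rewrite oppr_eq0.
have := @strip_ratio (- u) (- dotp u xb) (- dotp u xa) xa Nu0 Ka (dotNl _ _).
have b1 : 0 < - dotp u xa by lra.
have b2 : - dotp u xb <= - dotp u xa by lra.
move=> /(_ b1 b2) h; have {}h : - dotp u xb <= k * - dotp u xa.
  by apply: h => z /hab; rewrite dotNl !lerN2 andbC.
have : k * - dotp u xa <= 0 by rewrite mulr_le0_ge0 // ltW.
move=> h3; have kE : k * dotp u xa = 0 by lra.
move: kE => /eqP; rewrite mulf_eq0 => /orP[/eqP k00|/eqP]; last by lra.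
by move: ha; rewrite k00 mul0r; lra.
Qed.

(** For [k > 0] it is the whole of [k K], not a single point, that is separated from [K]. *)
Lemma K_scale_exists : exists2 x, K x & K (k *: x).
Proof.
have [k0|k0] := lerP k 0.
  by exists z0; [exact: K_z0|apply: K_scale => //; exact: K_z0].
apply: contrapT => nex; have [k1 _] := strip_pos.
have [|u [d d0 sep]] := @separate_scaled K k K_compact K_conv (ex_intro _ _
  K_z0).
  by move=> x Kx Kkx; apply: nex; exists x.
have u0 : u != 0.
  by apply/eqP => u0; have := sep _ _ K_z0 K_z0; rewrite u0 !dot0l; lra.
have [xa [xb [Ka Kb hab ltab]]] := linear_extrema u0.
have h := sep _ _ Kb Ka.
case: (ltrP 0 (dotp u xb)) => hb.
  by have := strip_ratio u0 Kb erefl hb (ltW ltab) hab; lra.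
by nra.
Qed.

(** Then [k *: x] has height [k * be]: these are the pairs of points in opposite faces on a line
    through 0. *)
Let X x := [/\ K x, dotp N x = be & K (k *: x)].

Lemma X_exists : exists x, X x.
Proof.
have [k0|k0] := lerP k 0.
  by exists x0; split => //; [case: k_strip|apply: K_scale => //;
    case: k_strip].
have [x Kx Kkx] := K_scale_exists; exists x; split => //.
have /andP[_ h1] := strip_bounds Kx; have /andP[h2 _] := strip_bounds Kkx.
apply/eqP; rewrite eq_le h1 /=; move: h2; rewrite dotZr ler_pM2l //.
Qed.

(** The square of the quarter turn is a point reflection, which keeps its form in the oblique frame
    [x], [th]. *)
Lemma half_turn x th : th != 0 -> dotp N th = 0 -> dotp N x != 0 ->
  exists c1 c2, forall s t, K (s *: x + t *: th) ->
    K ((c1 - s) *: x + (c2 - t) *: th).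
Proof.
move=> th0 Nth Nx; pose T := Num.sqrt (dotp th th).
have tt0 : 0 < dotp th th by rewrite dot_gt0.
have T0 : 0 < T by rewrite sqrtr_gt0.
have TN : T != 0 by rewrite gt_eqF.
have TT : T ^+ 2 = dotp th th by rewrite sqr_sqrtr // ltW.
have [q qE] : exists q, dotp th x = q * dotp th th.
  by exists (dotp th x / dotp th th); rewrite divfK // gt_eqF.
have [w wE] : exists w, x = w + q *: th by exists (x - q *: th); vec.
have thw : dotp th w = 0.
  have := congr1 (dotp th) wE; rewrite qE dotDr dotZr => /eqP.
  by rewrite -subr_eq0 opprD addrCA subrr addr0 oppr_eq0 => /eqP.
have w0 : w != 0.
  by apply: contraNneq Nx => w0;
    rewrite wE w0 dotDr dot0r dotZr Nth mulr0 addr0.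
pose W := Num.sqrt (dotp w w).
have ww0 : 0 < dotp w w by rewrite dot_gt0.
have W0 : 0 < W by rewrite sqrtr_gt0.
have WN : W != 0 by rewrite gt_eqF.
have aa := dot_normalized w0; rewrite -/W in aa.
have bb := dot_normalized th0; rewrite -/T in bb.
have ab : dotp (W^-1 *: w) (T^-1 *: th) = 0 by rewrite dotZl dotZr dotC thw;
  ring.
have [s0 [t0 turn]] := K_turn aa bb ab.
exists (2 * s0 / W), (2 * t0 / T - (2 * s0 / W) * q) => s t Ks.
have K1 : K (0 + (s0 + (s * W - s0)) *: (W^-1 *: w) +
    (t0 + ((t + s * q) * T - t0)) *: (T^-1 *: th)).
  by apply: (set_congr Ks); rewrite wE; apply/rowP => ?; rewrite !mxE; field;
    rewrite TN WN.
apply: (set_congr (turn _ _ (turn _ _ K1))).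
by rewrite wE; apply/rowP => ?; rewrite !mxE; field; rewrite TN WN.
Qed.

Lemma X_neq0 x : X x -> dotp N x != 0.
Proof. by move=> [_ -> _]; have [_ h] := strip_pos; rewrite gt_eqF. Qed.

(** The flipped points stay in the strip: the image of [x] gives [c1 >= 1 + k], that of [k *: x]
    gives [c1 <= 1 + k]. *)
Lemma face_flip x th : X x -> dotp N th = 0 -> th != 0 ->
  exists c, forall s t, K (s *: x + t *: th) ->
    K ((1 + k - s) *: x + (c - t) *: th).
Proof.
move=> Xx Nth th0; have [Kx Nx Kkx] := Xx; have [_ b0] := strip_pos.
have [c1 [c2 flip]] := half_turn th0 Nth (X_neq0 Xx).
have K1 : K (1 *: x + 0 *: th) by apply: (set_congr Kx); vec.
have K2 : K (k *: x + 0 *: th) by apply: (set_congr Kkx); vec.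
have /andP[h1 _] := strip_bounds (flip _ _ K1).
have /andP[_ h2] := strip_bounds (flip _ _ K2).
move: h1 h2; rewrite !dotE Nth Nx !mulr0 !addr0 => h1 h2.
have g1 : k <= c1 - 1 by rewrite -(ler_pM2r b0).
have g2 : c1 - k <= 1 by rewrite -(ler_pM2r b0) mul1r.
have c1E : c1 = 1 + k by lra.
by exists c2 => s t /flip; rewrite c1E.
Qed.

(** The flip sends [k x] to [x + c th] and [x] to [k x + c th]; for [0 < k < 1] the point
    [k (x + c th)] lies between [k x] and [k x + c th]. *)
Lemma bad_in_X x th c : X x -> dotp N th = 0 ->
  (forall s t, K (s *: x + t *: th) -> K ((1 + k - s) *: x + (c - t) *: th)) ->
  X (x + c *: th).
Proof.
move=> [Kx Nx Kkx] Nth flip.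
have K1 : K (x + c *: th).
  have K2 : K (k *: x + 0 *: th) by apply: (set_congr Kkx); vec.
  by apply: (set_congr (flip _ _ K2)); vec.
split => //; first by rewrite dotDr dotZr Nth mulr0 addr0.
have [k0|k0] := lerP k 0; first exact: K_scale.
have [k1 _] := strip_pos.
have K3 : K (k *: x + c *: th).
  have K4 : K (1 *: x + 0 *: th) by apply: (set_congr Kx); vec.
  by apply: (set_congr (flip _ _ K4)); vec.
have hk : 0 <= k <= 1 by rewrite !ltW.
by apply: (set_congr (K_conv hk Kkx K3)); vec.
Qed.
Lemma X_conv x y s : 0 <= s <= 1 -> X x -> X y -> X ((1 - s) *: x + s *: y).
Proof.
move=> hs [Kx Nx Kkx] [Ky Ny Kky]; split; first exact: K_conv.
  by rewrite dotDr !dotZr Nx Ny; ring.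
by apply: (set_congr (K_conv hs Kkx Kky)); vec.
Qed.

Lemma K_ray x d : dotp d d = 1 -> K x -> exists s, [/\ 0 <= s, K (x + s *: d) &
  forall s', K (x + s' *: d) -> s' <= s].
Proof.
by have [M _ hM] := compact_dot_bounded K_compact; exact: (ray_max K_closed hM).
Qed.

(** * Two-dimensional slices of the two faces *)

Section PlanarFace.
Variables (a b zc : 'rV[R]_n).
Hypotheses (aa : dotp a a = 1) (bb : dotp b b = 1) (ab : dotp a b = 0).
Hypotheses (Na : dotp N a = 0) (Nb : dotp N b = 0) (k_gt : -1 < k).

Let disc (y : 'rV[R]_n) dl := forall s t, s ^+ 2 + t ^+ 2 < dl ^+ 2 ->
  K (y + (s *: a + t *: b)).

Hypothesis Xzc : X zc.
Hypothesis zc_disc : exists2 dl, 0 < dl & disc zc dl.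
Hypothesis kzc_disc : k != 0 -> exists2 dl, 0 < dl & disc (k *: zc) dl.

Lemma dot_plane s t s' t' :
  dotp (s *: a + t *: b) (s' *: a + t' *: b) = s * s' + t * t'.
Proof. by rewrite !dotE aa bb ab (dotC b) ab; ring. Qed.

Lemma dotN_plane s t : dotp N (s *: a + t *: b) = 0.
Proof. by rewrite !dotE Na Nb; ring. Qed.

Lemma disc_toward y y' dl m : disc y dl -> K y' -> 0 <= m < 1 ->
  disc ((1 - m) *: y + m *: y') ((1 - m) * dl).
Proof.
move=> hd Ky' /andP[m0 m1] s t hst; have m2 : 0 < 1 - m by lra.
have hm : 0 <= m <= 1 by rewrite m0 ltW.
have K1 : K (y + ((s / (1 - m)) *: a + (t / (1 - m)) *: b)).
  apply: hd; rewrite !expr_div_n -mulrDl ltr_pdivrMr ?exprn_gt0 //.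
  by rewrite -exprMn mulrC.
apply: (set_congr (K_conv hm K1 Ky')).
by apply/rowP => ?; rewrite !mxE; field; rewrite gt_eqF.
Qed.

(** [k *: y] is to be interior to the planar slice of the lower face. For [k = 0] all [y] share the
    lower point 0, and the disc about [zc] takes over. *)
Let good y := X y /\ (k != 0 -> exists2 dl, 0 < dl & disc (k *: y) dl).

Lemma good_of_disc y : K y -> dotp N y = be ->
  (k != 0 -> exists2 dl, 0 < dl & disc (k *: y) dl) -> good y.
Proof.
move=> Ky Ny hd; split => //; split => //.
have [k0|/hd[dl dl0 h]] := eqVneq k 0; first by apply: K_scale; rewrite ?k0.
have K1 : K (k *: y + (0 *: a + 0 *: b)) by apply: h;
  have := exprn_gt0 2 dl0; lra.
by apply: (set_congr K1); vec.
Qed.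

(** The half length [dl] does not depend on the direction. It comes by a flip from the disc about
    [k *: y] or, for [k = 0], by two flips through 0 from the disc about [zc]. *)
Lemma good_wide y : good y -> exists2 dl, 0 < dl & forall s t,
  0 < s ^+ 2 + t ^+ 2 <= 4 -> exists c, K (y + (c + dl) *: (s *: a + t *: b)) /\
    K (y + (c - dl) *: (s *: a + t *: b)).
Proof.
move=> [Xy hd].
have th0 s t : 0 < s ^+ 2 + t ^+ 2 -> s *: a + t *: b != 0.
  by rewrite -dot_gt0 dot_plane -!expr2.
have chord u dl s t m : 0 < dl -> disc u dl -> s ^+ 2 + t ^+ 2 <= 4 -> m ^+ 2
  = 1 ->
    K (u + (m * (dl / 4)) *: (s *: a + t *: b)).
  move=> dl0 h hst mm.
  have K1 : K (u + ((m * (dl / 4) * s) *: a + (m * (dl / 4) * t) *: b)).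
    apply: h; have -> : (m * (dl / 4) * s) ^+ 2 + (m * (dl / 4) * t) ^+ 2 =
      m ^+ 2 * (dl ^+ 2 / 16 * (s ^+ 2 + t ^+ 2)) by field.
    by rewrite mm mul1r; have := exprn_gt0 2 dl0; nra.
  by apply: (set_congr K1); vec.
have m1 : 1 ^+ 2 = 1 :> R by rewrite expr1n.
have m2 : (-1) ^+ 2 = 1 :> R by rewrite sqrrN expr1n.
have [k0|/hd[dl dl0 h]] := eqVneq k 0.
  have [dl dl0 h] := zc_disc; exists (dl / 4); first by rewrite divr_gt0.
  move=> s t /andP[st0 st4].
  have [c flip] := face_flip Xy (dotN_plane s t) (th0 _ _ st0).
  have [c1 flip1] := face_flip Xzc (dotN_plane s t) (th0 _ _ st0).
  exists (c - c1).
  have via m : m ^+ 2 = 1 -> K (y + (c - c1 + m * (dl / 4)) *: (s *: a + t *: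
    b)).
    move=> mm; have K1 : K (1 *: zc + (m * (dl / 4)) *: (s *: a + t *: b)).
      by rewrite scale1r; exact: chord.
    have K2 : K (0 *: y + (c1 - m * (dl / 4)) *: (s *: a + t *: b)).
      by apply: (set_congr (flip1 _ _ K1)); rewrite k0; vec.
    by apply: (set_congr (flip _ _ K2)); rewrite k0; vec.
  split; first by apply: (set_congr (via _ m1)); vec.
  by apply: (set_congr (via _ m2)); vec.
exists (dl / 4) => [|s t /andP[st0 st4]]; first by rewrite divr_gt0.
have [c flip] := face_flip Xy (dotN_plane s t) (th0 _ _ st0); exists c.
split; first by apply: (set_congr (flip _ _ (chord _ _ _ _ _ dl0 h st4 m2)));
  vec.
by apply: (set_congr (flip _ _ (chord _ _ _ _ _ dl0 h st4 m1))); vec.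
Qed.

(* The chords of the two faces through [y] and [k *: y] have the same length,
   and [`|k| < 1], so one endpoint of the first one is mapped by [k] into the
   interior of the second one. *)
Lemma good_endpoint y s t : good y -> s ^+ 2 + t ^+ 2 = 1 ->
  exists sg T, [/\ sg = 1 \/ sg = -1, good (y + T *: (s *: a + t *: b)) &
    forall eps, 0 < eps ->
      ~ K (y + T *: (s *: a + t *: b) + (sg * eps) *: (s *: a + t *: b))].
Proof.
move=> gy st; have [Xy hd] := gy; have [Ky Ny _] := Xy.
have [d dE] : exists d, d = s *: a + t *: b by eexists.
have dd : dotp d d = 1 by rewrite dE dot_plane -!expr2.
have Nd : dotp N d = 0 by rewrite dE dotN_plane.
have dd' : dotp (- d) (- d) = 1 by rewrite dotNl dotNr opprK.
have [tb [tb0 Ktb tbm]] := K_ray dd Ky.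
have [ta [ta0 Kta tam]] := K_ray dd' Ky.
have d0 : d != 0 by rewrite -dot_gt0 dd.
have Nyd T : dotp N (y + T *: d) = be by rewrite dotDr dotZr Nd mulr0 addr0.
have out1 eps : 0 < eps -> ~ K (y + tb *: d + (1 * eps) *: d).
  move=> e0 Ke; have : tb + eps <= tb by apply: tbm; apply: (set_congr Ke); vec.
  by lra.
have out2 eps : 0 < eps -> ~ K (y + (- ta) *: d + (-1 * eps) *: d).
  move=> e0 Ke; have : ta + eps <= ta by apply: tam; apply: (set_congr Ke); vec.
  by lra.
rewrite -dE; have [k0|kN] := eqVneq k 0.
  exists 1, tb; split; [by left| |exact: out1].
  by apply: good_of_disc => //; rewrite k0 eqxx.
have Kta' : K (y + (- ta) *: d) by apply: (set_congr Kta); vec.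
have [dl dl0 hdl] := hd kN.
have [c flip] := face_flip Xy Nd d0.
have Klo : K (k *: y + (c - tb) *: d).
  have K1 : K (1 *: y + tb *: d) by rewrite scale1r.
  by apply: (set_congr (flip _ _ K1)); vec.
have Khi : K (k *: y + (c + ta) *: d).
  have K1 : K (1 *: y + (- ta) *: d) by rewrite scale1r.
  by apply: (set_congr (flip _ _ K1)); vec.
have half m : m ^+ 2 = 1 -> K (y + (c - m * (dl / 2)) *: d).
  move=> mm; have K1 : K (k *: y + ((m * (dl / 2) * s) *: a + (m * (dl / 2) *
    t) *: b)).
    apply: hdl; have -> : (m * (dl / 2) * s) ^+ 2 + (m * (dl / 2) * t) ^+ 2 =
      m ^+ 2 * (dl ^+ 2 / 4 * (s ^+ 2 + t ^+ 2)) by field.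
    by rewrite mm st; have := exprn_gt0 2 dl0; lra.
  have K2 : K (k *: y + (m * (dl / 2)) *: d) by apply: (set_congr K1);
    rewrite dE; vec.
  by apply: (set_congr (flip _ _ K2)); vec.
have lo0 : c - tb <= - (dl / 2).
  have : c + dl / 2 <= tb.
    by apply: tbm; apply: (set_congr (half (-1) _)); [rewrite sqrrN expr1n|vec].
  by lra.
have hi0 : dl / 2 <= c + ta.
  have : - (c - dl / 2) <= ta.
    by apply: tam; apply: (set_congr (half 1 _)); [rewrite expr1n|vec].
  by lra.
have dl2 : 0 < dl / 2 by rewrite divr_gt0.
have inside T : K (y + T *: d) -> c - tb < k * T < c + ta -> good (y + T *: d).
  move=> KT /andP[h1 h2]; apply: good_of_disc => // _.
  have [kT|kT] := lerP 0 (k * T).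
    have hi : 0 < c + ta by lra.
    have hm : 0 <= k * T / (c + ta) < 1.
      by rewrite divr_ge0 ?(ltW hi) // ltr_pdivrMr // mul1r.
    exists ((1 - k * T / (c + ta)) * dl).
      by rewrite mulr_gt0 // subr_gt0; case/andP: hm.
    have := disc_toward hdl Khi hm; congr (disc _ _).
    by apply/rowP => ?; rewrite !mxE; field; rewrite gt_eqF.
  have lo : c - tb < 0 by lra.
  have hm : 0 <= k * T / (c - tb) < 1.
    rewrite -[k * T / _]opprK -mulNr -mulrN -invrN.
    have lo' : 0 < - (c - tb) by lra.
    by rewrite divr_ge0 ?(ltW lo') ?ltr_pdivrMr //; lra.
  exists ((1 - k * T / (c - tb)) * dl).
    by rewrite mulr_gt0 // subr_gt0; case/andP: hm.
  have := disc_toward hdl Klo hm; congr (disc _ _).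
  by apply/rowP => ?; rewrite !mxE; field; rewrite lt_eqF.
have [k1 _] := strip_pos; have kl := k_gt.
have [h|h] := boolP (c - tb < k * tb < c + ta).
  by exists 1, tb; split; [left|exact: inside|exact: out1].
exists (-1), (- ta); split; [by right| |exact: out2].
apply: inside => //; move: h; rewrite negb_and -!leNgt => h.
have S0 : 0 < ta + tb by lra.
have S1 : 0 < (1 - k) * (ta + tb) by rewrite mulr_gt0 // subr_gt0.
have S2 : 0 < (1 + k) * (ta + tb) by rewrite mulr_gt0 //; lra.
have [kp|kp] := lerP 0 k.
  have A1 : 0 <= k * ta by rewrite mulr_ge0.
  have A2 : 0 <= k * tb by rewrite mulr_ge0.
  by case/orP: h => h; lra.
have A1 : k * ta <= 0 by rewrite mulr_le0_ge0 // ltW.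
have A2 : k * tb <= 0 by rewrite mulr_le0_ge0 // ltW.
by case/orP: h => h; lra.
Qed.

Lemma plane_closed y1 : closed [set y | K y /\ exists s t,
  y = y1 + (s *: a + t *: b)].
Proof.
move=> x /closure_dotP h; split.
  by apply: K_closed => e /h[y [Ky _] d]; exists y.
(* The projection along [span(a, b)] onto its orthogonal complement, which does not increase
   norms. *)
pose g u := u - (dotp u a *: a + dotp u b *: b).
have g_le u : dotp (g u) (g u) <= dotp u u.
  have -> : dotp (g u) (g u) = dotp u u - (dotp u a) ^+ 2 - (dotp u b) ^+ 2.
    by rewrite /g !dotE aa bb ab (dotC b a) ab (dotC a u) (dotC b u); ring.
  by have := sqr_ge0 (dotp u a); have := sqr_ge0 (dotp u b); lra.
exists (dotp (x - y1) a), (dotp (x - y1) b).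
apply/eqP; rewrite addrC -subr_eq eq_sym -subr_eq0; apply/negPn/negP => gN.
have g0 : 0 < dotp (g (x - y1)) (g (x - y1)).
  by rewrite dot_gt0 -oppr_eq0 /g opprB.
have [y [_ [s [t yE]]] d] := h _ g0.
move: d; rewrite ltNge => /negP; apply.
have -> : g (x - y1) = g (x - y).
  have E : x - y1 = x - y + (s *: a + t *: b) by rewrite yE; vec.
  rewrite /g E !dotDl !dotZl aa bb ab (dotC b) ab; vec.
by apply: le_trans (g_le _) _; rewrite -[y - x]opprB dotNl dotNr opprK.
Qed.

(** Projecting an outer point to the slice yields a good point [w] with a support line; let [w1] be
    the last point of [K] on that line in one direction. In slightly tilted directions the chords of
    uniform length at [w1] must extend forward, and in the limit they pass beyond [w1]. *)
Lemma no_planar_face : False.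
Proof.
have gz : good zc by [].
have u1 : 1 ^+ 2 + 0 ^+ 2 = 1 :> R by rewrite expr1n expr0n addr0.
have [sg [T [sgE]]] := good_endpoint gz u1.
set y1 := zc + _ => g1 out; have [[Ky1 Ny1 _] hd1] := g1.
have sg2 : sg ^+ 2 = 1 by case: sgE => ->; rewrite ?sqrrN expr1n.
(* Points of the slice near [y1] inherit goodness from the disc about [k *: y1]. *)
have [eta eta0 near1] : exists2 eta, 0 < eta & forall s t,
    s ^+ 2 + t ^+ 2 <= 4 * eta ^+ 2 -> K (y1 + (s *: a + t *: b)) ->
    good (y1 + (s *: a + t *: b)).
  have Nw s t : dotp N (y1 + (s *: a + t *: b)) = be.
    by rewrite dotDr dotN_plane addr0.
  have [k0|/hd1[dl dl0 h]] := eqVneq k 0.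
    by exists 1 => // s t _ Kw; apply: good_of_disc => //; rewrite k0 eqxx.
  exists (dl / 4) => [|s t hst Kw]; first by rewrite divr_gt0.
  apply: good_of_disc => // _; exists (dl / 2) => [|s' t' hst'];
    first by rewrite divr_gt0.
  have K1 : K (k *: y1 + ((k * s + s') *: a + (k * t + t') *: b)).
    apply: h; have /andP[ka kb] := k_itv.
    have k2 : k ^+ 2 <= 1 by nra.
    have : k ^+ 2 * (s ^+ 2 + t ^+ 2) <= s ^+ 2 + t ^+ 2.
      by apply: ler_piMl => //; rewrite addr_ge0 ?sqr_ge0.
    have := sqr_ge0 (k * s - s'); have := sqr_ge0 (k * t - t').
    have E1 : 4 * (dl / 4) ^+ 2 = dl ^+ 2 / 4 by field.
    have E2 : (dl / 2) ^+ 2 = dl ^+ 2 / 4 by field.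
    by rewrite E1 in hst; rewrite E2 in hst'; lra.
  by apply: (set_congr K1); vec.
have [q qE] : exists q, q = y1 + (sg * eta) *: a by eexists.
have Kq : ~ K q.
  move=> Kq; apply: (out _ eta0); apply: (set_congr Kq); rewrite qE; vec.
have [|w [Kw [s [t wE]]] wm] := nearest_point q (@plane_closed y1).
  by exists y1; split => //; exists 0, 0; vec.
have in_plane s' t' : K (w + (s' *: a + t' *: b)) ->
    dotp (w - q) (w - q) <= dotp (w + (s' *: a + t' *: b) - q) (w + (s' *: a +
      t' *: b) - q).
  by move=> K1; apply: wm; split => //; exists (s + s'), (t + t');
    rewrite wE; vec.
have wq : w - q = (s - sg * eta) *: a + t *: b by rewrite wE qE; vec.
(* [w] is within [2 * eta] of [y1], because [|w - q| <= |y1 - q| = eta]. *)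
have gw : good w.
  rewrite wE; apply: near1; last by rewrite -wE.
  have [] : [set y | K y /\ exists s t, y = y1 + (s *: a + t *: b)] y1.
    by split => //; exists 0, 0; vec.
  move=> _ h0; have := wm _ (conj Ky1 h0).
  have -> : y1 - q = (- (sg * eta)) *: a + 0 *: b by rewrite qE; vec.
  rewrite wq !dot_plane; have := sqr_ge0 (s - 2 * sg * eta).
  have -> : (s - 2 * sg * eta) ^+ 2 = s ^+ 2 - 4 * sg * eta * s + 4 * eta ^+ 2
    * sg ^+ 2 by ring.
  by have := sqr_ge0 t; rewrite sg2; lra.
pose n1 := sg * eta - s; pose n2 := - t.
have qw : q - w = n1 *: a + n2 *: b by rewrite -[q - w]opprB wq /n1 /n2; vec.
pose D := Num.sqrt (n1 ^+ 2 + n2 ^+ 2).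
have nn0 : 0 < n1 ^+ 2 + n2 ^+ 2.
  have E : dotp (q - w) (q - w) = n1 ^+ 2 + n2 ^+ 2 by rewrite qw dot_plane.
  by rewrite -E dot_gt0 subr_eq0; apply/eqP => qw0; apply: Kq; rewrite qw0.
have D0 : 0 < D by rewrite sqrtr_gt0.
have DN : D != 0 by rewrite gt_eqF.
have DD : D ^+ 2 = n1 ^+ 2 + n2 ^+ 2 by rewrite sqr_sqrtr // ltW.
have support s' t' : K (w + (s' *: a + t' *: b)) -> n1 * s' + n2 * t' <= 0.
  move=> K1; rewrite -dot_plane -qw; apply: nearest_obtuse => m hm.
  have Km := K_conv hm Kw K1.
  have E : (1 - m) *: w + m *: (w + (s' *: a + t' *: b)) = w + ((m * s') *: a
    + (m * t') *: b).
    by vec.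
  rewrite E in Km; have := in_plane _ _ Km.
  by rewrite (_ : (m * s') *: a + (m * t') *: b = m *: (s' *: a + t' *: b))
    //; vec.
(* The unit direction of the support line at [w]. *)
have u2 : (- n2 / D) ^+ 2 + (n1 / D) ^+ 2 = 1.
  have -> : (- n2 / D) ^+ 2 + (n1 / D) ^+ 2 = (n1 ^+ 2 + n2 ^+ 2) / D ^+ 2
    by field.
  by rewrite DD mulfV // gt_eqF.
have [sg' [T' [sgE']]] := good_endpoint gw u2.
set w1 := w + _ => gw1 out1; have [[Kw1 _ _] _] := gw1.
have sg2' : sg' ^+ 2 = 1 by case: sgE' => ->; rewrite ?sqrrN expr1n.
have support1 s' t' : K (w1 + (s' *: a + t' *: b)) -> n1 * s' + n2 * t' <= 0.
  move=> K1; have /support : K (w + ((T' * (- n2 / D) + s') *: a + (T' * (n1 /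
    D) + t') *: b)).
    by apply: (set_congr K1); rewrite /w1; vec.
  suff -> : n1 * (T' * (- n2 / D) + s') + n2 * (T' * (n1 / D) + t') = n1 * s'
    + n2 * t' by [].
  by field.
have [dl dl0 wide] := good_wide gw1.
apply: (out1 _ dl0); apply: K_closed => e e0.
pose eps := Num.min (D^-1) (e / (2 * dl ^+ 2 * D)).
have P0 : 0 < 2 * dl ^+ 2 * D by rewrite mulr_gt0 // mulr_gt0 // exprn_gt0.
have eps0 : 0 < eps by rewrite lt_min invr_gt0 D0 divr_gt0.
have eps1 : eps * D <= 1 by rewrite -ler_pdivlMr // mul1r ge_min lexx.
have eps2 : eps * (2 * dl ^+ 2 * D) <= e
  by rewrite -ler_pdivlMr // ge_min lexx orbT.
(* The tangent tilted inward by [eps] times the normal; [eps * D <= 1] keeps it in the range of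
   [good_wide]. *)
pose s2 := sg' * (- n2 / D) - eps * n1; pose t2 := sg' * (n1 / D) - eps * n2.
have norm2 : s2 ^+ 2 + t2 ^+ 2 = 1 + (eps * D) ^+ 2.
  have -> : s2 ^+ 2 + t2 ^+ 2 = sg' ^+ 2 * ((- n2 / D) ^+ 2 + (n1 / D) ^+ 2) +
     eps ^+ 2 * (n1 ^+ 2 + n2 ^+ 2) by rewrite /s2 /t2; field.
  by rewrite u2 sg2' -DD; ring.
have epsD : 0 < eps * D by rewrite mulr_gt0.
have [|c [Kp Km]] := wide s2 t2; first by rewrite norm2; apply/andP; split; nra.
(* For [c < dl] the rear end of the chord would cross the support line. *)
have cd : dl <= c.
  have := support1 ((c - dl) * s2) ((c - dl) * t2).
  have -> : n1 * ((c - dl) * s2) + n2 * ((c - dl) * t2) =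
     - ((c - dl) * (eps * (n1 ^+ 2 + n2 ^+ 2))) by rewrite /s2 /t2; field.
  rewrite oppr_le0 pmulr_lge0; last by rewrite mulr_gt0.
  by rewrite subr_ge0; apply; apply: (set_congr Km); vec.
exists (w1 + dl *: (s2 *: a + t2 *: b)).
  have cp : 0 < c + dl by lra.
  have hm : 0 <= dl / (c + dl) <= 1.
    by rewrite divr_ge0 ?(ltW dl0) ?(ltW cp) // ler_pdivrMr // mul1r; lra.
  apply: (set_congr (K_conv hm Kw1 Kp)).
  by apply/rowP => ?; rewrite !mxE; field; rewrite DN gt_eqF.
have -> : w1 + dl *: (s2 *: a + t2 *: b) -
    (w1 + (sg' * dl) *: ((- n2 / D) *: a + (n1 / D) *: b)) =
    (- (dl * eps * n1)) *: a + (- (dl * eps * n2)) *: b.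
  by rewrite /s2 /t2; apply/rowP => ?; rewrite !mxE; field.
rewrite dot_plane.
have -> : - (dl * eps * n1) * - (dl * eps * n1) + - (dl * eps * n2) * - (dl *
  eps * n2) =
  dl ^+ 2 * (eps * D) ^+ 2 by rewrite exprMn DD; ring.
have := exprn_gt0 2 dl0; move: (dl ^+ 2) eps2 => q2 eps2 q20.
have : q2 * (eps * D) ^+ 2 <= q2 * (eps * D) by rewrite ler_pM2l // expr2; nra.
by lra.
Qed.

End PlanarFace.

(** * From triangles in the faces to a center of symmetry *)

Lemma K_conv3 y u v al ga :
  K y -> K (y + u) -> K (y + v) -> 0 <= al -> 0 <= ga ->
  al + ga <= 1 -> K (y + (al *: u + ga *: v)).
Proof.
move=> Ky Ku Kv al0 ga0 s1; have [s0|s0] := eqVneq (al + ga) 0.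
  have -> : al = 0 by lra.
  have -> : ga = 0 by lra.
  by apply: (set_congr Ky); vec.
have sp : 0 < al + ga by rewrite lt_def s0 addr_ge0.
have h1 : 0 <= ga / (al + ga) <= 1.
  by rewrite divr_ge0 ?(ltW sp) //= ler_pdivrMr // mul1r lerDr.
have h2 : 0 <= al + ga <= 1 by rewrite (ltW sp).
apply: (set_congr (K_conv h2 Ky (K_conv h1 Ku Kv))).
by apply/rowP => ?; rewrite !mxE; field.
Qed.

(** The disc is centered at the centroid: changes [d1], [d2] of two barycentric coordinates with
    [|d1| + |d2| <= 1/6] stay inside the triangle. *)
Lemma triangle_disc y a b p q1 q2 :
  p != 0 -> q2 != 0 -> K y -> K (y + p *: a) ->
  K (y + (q1 *: a + q2 *: b)) -> exists2 dl, 0 < dl & forall s t,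
  s ^+ 2 + t ^+ 2 < dl ^+ 2 ->
  K (y + (3^-1 *: (p *: a) + 3^-1 *: (q1 *: a + q2 *: b)) + (s *: a + t *: b)).
Proof.
move=> p0 q0 Ky K1 K2; pose C := 1 + `|p^-1| + `|q1 / (q2 * p)| + `|q2^-1|.
have C0 : 0 < C.
  by rewrite /C; have := normr_ge0 p^-1; have := normr_ge0 q2^-1;
    have := normr_ge0 (q1 / (q2 * p)); lra.
have [r C6 CE] : exists2 r, 0 < r & r * C = 6^-1.
  by exists (6 * C)^-1; [rewrite invr_gt0 mulr_gt0|field; rewrite gt_eqF].
exists r => // s t hst.
have small q : q ^+ 2 < r ^+ 2 -> `|q| <= r.
  move=> h; rewrite ltW // -(@ltr_pXn2r _ 2) ?nnegrE ?(ltW C6) //.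
  by rewrite real_normK ?num_real.
have hs : `|s| <= r by apply: small; have := sqr_ge0 t; lra.
have ht : `|t| <= r by apply: small; have := sqr_ge0 s; lra.
pose d1 := s / p - t * (q1 / (q2 * p)); pose d2 := t / q2.
have hd : `|d1| + `|d2| <= 6^-1.
  rewrite -CE; apply: (@le_trans _ _ (`|s| * `|p^-1| + `|t| * `|q1 / (q2 * p)|
    + `|t| * `|q2^-1|)).
    by rewrite /d1 /d2 (normrM t) lerD2r (le_trans (ler_normB _ _)) //
      !(normrM s) (normrM t).
  have h1 : `|s| * `|p^-1| <= r * `|p^-1| by rewrite ler_wpM2r.
  have h2 : `|t| * `|q1 / (q2 * p)| <= r * `|q1 / (q2 * p)|
    by rewrite ler_wpM2r.
  have h3 : `|t| * `|q2^-1| <= r * `|q2^-1| by rewrite ler_wpM2r.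
  by rewrite /C; lra.
have := normr_ge0 d1; have := normr_ge0 d2.
have := ler_norm d1; have := ler_norm d2; have := ler_norm (- d1);
  have := ler_norm (- d2).
rewrite !normrN => ? ? ? ? ? ?.
have K3 : K (y + ((3^-1 + d1) *: (p *: a) + (3^-1 + d2) *: (q1 *: a + q2 *:
  b))).
  by apply: K_conv3 => //; lra.
apply: (set_congr K3); rewrite /d1 /d2; apply/rowP => ?; rewrite !mxE; field.
by rewrite p0 q0.
Qed.

(** Three such points span homothetic triangles in the two faces, whose centroids carry the discs
    that [no_planar_face] excludes. *)
Lemma X_not_triangle x f1 f2 : -1 < k -> X x -> X (x + f1) -> X (x + f2) ->
  f1 != 0 -> (forall s, f2 != s *: f1) -> False.
Proof.
move=> k_gt Xx X1 X2 f10 f2N.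
have Nf f : X (x + f) -> dotp N f = 0.
  by move=> [_ + _]; have [_ Nx _] := Xx; rewrite dotDr Nx; lra.
have F0 : 0 < dotp f1 f1 by rewrite dot_gt0.
pose P := Num.sqrt (dotp f1 f1); have P0 : 0 < P by rewrite sqrtr_gt0.
have PP : P ^+ 2 = dotp f1 f1 by rewrite sqr_sqrtr // ltW.
have aa := dot_normalized f10; rewrite -/P in aa.
have [a aE] : exists a, a = P^-1 *: f1 by eexists.
rewrite -aE in aa.
have f1E : f1 = P *: a by rewrite aE scalerA mulfV ?scale1r // gt_eqF.
pose q1 := dotp a f2; have [w wE] : exists w, f2 = q1 *: a + w.
  by exists (f2 - q1 *: a); vec.
have aw : dotp a w = 0.
  have := erefl (dotp a f2); rewrite {2}wE dotDr dotZr aa -/q1 => /eqP.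
  by rewrite mulr1 -subr_eq0 opprD addNKr oppr_eq0 => /eqP.
have w0 : w != 0.
  apply: contraTneq isT => w0; have := f2N (q1 / P).
  by rewrite wE w0 addr0 aE scalerA eqxx.
pose q2 := Num.sqrt (dotp w w).
have q20 : 0 < q2 by rewrite sqrtr_gt0 dot_gt0.
have bb := dot_normalized w0; rewrite -/q2 in bb.
have [b bE] : exists b, b = q2^-1 *: w by eexists.
rewrite -bE in bb.
have wb : w = q2 *: b by rewrite bE scalerA mulfV ?scale1r // gt_eqF.
have ab : dotp a b = 0 by rewrite bE dotZr aw mulr0.
have Na : dotp N a = 0 by rewrite aE dotZr Nf // mulr0.
have Nb : dotp N b = 0.
  have := Nf _ X2; rewrite wE wb dotDr !dotZr Na mulr0 add0r => /eqP.
  by rewrite mulf_eq0 gt_eqF // => /eqP.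
rewrite f1E in X1; rewrite wE wb in X2.
have PN : P != 0 by rewrite gt_eqF.
have qN : q2 != 0 by rewrite gt_eqF.
have [Kx _ Kkx] := Xx; have [K1 _ Kk1] := X1; have [K2 _ Kk2] := X2.
pose z := x + (3^-1 *: (P *: a) + 3^-1 *: (q1 *: a + q2 *: b)).
apply: (@no_planar_face a b z aa bb ab Na Nb k_gt).
- have h1 : 0 <= (2^-1 : R) <= 1 by lra.
  have h2 : 0 <= (2 / 3 : R) <= 1 by lra.
  have := X_conv h2 Xx (X_conv h1 X1 X2); congr X.
  by apply/rowP => ?; rewrite !mxE; field.
- exact: triangle_disc.
- move=> kN; have kP : k * P != 0 by rewrite mulf_neq0.
  have kq : k * q2 != 0 by rewrite mulf_neq0.
  have Kk1' : K (k *: x + (k * P) *: a) by apply: (set_congr Kk1); vec.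
  have Kk2' : K (k *: x + ((k * q1) *: a + (k * q2) *: b))
    by apply: (set_congr Kk2); vec.
  have [dl dl0 h] := triangle_disc kP kq Kkx Kk1' Kk2'.
  by exists dl => // s t /h h'; apply: (set_congr h'); rewrite /z; vec.
Qed.

(** If the section through [x] and [th] is not centered at [(1 + k) / 2 x], then [X] has a second
    point along [th]; as [X] contains no triangle, all such [th] are parallel to one [f1]. *)
Lemma strip_center : -1 < k -> exists m, forall z, K z -> K (2 *: m - z).
Proof.
move=> k_gt; have [x Xx] := X_exists; have [Kx Nx Kkx] := Xx.
have [_ b0] := strip_pos; have bN : be != 0 by rewrite gt_eqF.
pose flips th := forall s t, K (s *: x + t *: th) ->
  K ((1 + k - s) *: x + (- t) *: th).
have bad th : dotp N th = 0 -> th != 0 -> ~ flips th ->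
    exists2 c, c != 0 & X (x + c *: th).
  move=> Nth th0 nf; have [c flip] := face_flip Xx Nth th0.
  exists c; last exact: bad_in_X.
  by apply/eqP => c0; apply: nf => s t /flip; rewrite c0 sub0r.
have [f1 f1P] : exists f1, forall th, dotp N th = 0 -> th != 0 ->
    (forall s, th != s *: f1) -> flips th.
  have [[f1 [f10 X1]]|none] := pselect (exists f, f != 0 /\ X (x + f)).
    exists f1 => th Nth th0 thN; apply: contrapT => /(bad _ Nth th0)[c c0 Xc].
    apply: (X_not_triangle k_gt Xx X1 Xc f10) => s.
    apply: contra (thN (c^-1 * s)) => /eqP E.
    by rewrite -scalerA -E scalerA mulVf // scale1r.
  exists 0 => th Nth th0 _; apply: contrapT => /(bad _ Nth th0)[c c0 Xc].
  by apply: none; exists (c *: th); rewrite scaler_eq0 negb_or c0.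
exists (((1 + k) / 2) *: x) => z Kz.
have [om [omom omx omf]] := unit_orthogonal2 x f1 n3.
(* The plane through [x] and such a [y] is not exceptional, since [om] is orthogonal to [f1] but not
   to [th]. *)
have reflect y : K y -> dotp om y != 0 -> K ((1 + k) *: x - y).
  move=> Ky oy; pose th := y - (dotp N y / be) *: x.
  have oth : dotp om th != 0 by rewrite /th dotDr dotNr dotZr omx mulr0 subr0.
  have th0 : th != 0 by apply: contraNneq oth => ->; rewrite dot0r.
  have Nth : dotp N th = 0 by rewrite /th dotDr dotNr dotZr Nx divfK // subrr.
  have thN s : th != s *: f1.
    by apply: contraNneq oth => ->; rewrite dotZr omf mulr0.
  have K1 : K ((dotp N y / be) *: x + 1 *: th) by apply: (set_congr Ky);
    rewrite /th; vec.
  by apply: (set_congr (f1P _ Nth th0 thN _ _ K1)); rewrite /th; vec.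
have -> : 2 *: (((1 + k) / 2) *: x) - z = (1 + k) *: x - z.
  by apply/rowP => ?; rewrite !mxE; field.
have [omz|] := eqVneq (dotp om z) 0; last exact: reflect.
have o0 : om != 0 by rewrite -dot_gt0 omom.
have [w Kw ow] : exists2 w, K w & dotp om w != 0.
  have [z1 [z2 [K1 K2 lt12]]] := K_nonflat o0.
  have [w1|w1] := eqVneq (dotp om z1) 0; last by exists z1.
  by exists z2 => //; rewrite gt_eqF // -w1.
(* The remaining points are limits of points covered by [reflect]. *)
apply: K_closed => e e0; pose q := dotp (w - z) (w - z).
have q0 : 0 <= q by exact: dot_ge0.
pose s := Num.min 1 (e / (q + 1)).
have D0 : 0 < q + 1 by lra.
have s0 : 0 < s by rewrite lt_min ltr01 divr_gt0.
have s1 : s <= 1 by rewrite ge_min lexx.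
have se : s * (q + 1) <= e by rewrite -ler_pdivlMr // ge_min lexx orbT.
have hs : 0 <= s <= 1 by rewrite ltW.
exists ((1 + k) *: x - ((1 - s) *: z + s *: w)).
  apply: reflect; first exact: K_conv.
  by rewrite dotDr !dotZr omz mulr0 add0r mulf_neq0 // gt_eqF.
have -> : (1 + k) *: x - ((1 - s) *: z + s *: w) - ((1 + k) *: x - z) = (- s)
  *: (w - z).
  by vec.
rewrite !(dotZl, dotZr) -/q; have : s * s <= s by nra.
by nra.
Qed.

End ExtremalStrip.

Lemma central_symmetry : exists m, forall z, K z -> K (2 *: m - z).
Proof.
have [k [N [x0 [NN k_strip k_itv k_max]]]] := extremal_strip.
have [k1|k1] := eqVneq k (-1); last first.
  apply: (@strip_center k N x0) => //; have /andP[h _] := k_itv.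
  by rewrite lt_def k1.
exists 0 => z Kz; have k0 : k <= 0 by rewrite k1; lra.
by apply: (set_congr (K_scale k_max k0 Kz)); rewrite k1; vec.
Qed.

End CentralSymmetry.

(** * Recentering and conclusion *)

Unset Implicit Arguments.
Set Strict Implicit.

Theorem corollary1p7 (R : realType) (n : nat) (hn : (3 <= n)%N)
    (K : set 'rV[R]_n) (hK : convex_body K)
    (hsym : forall H : {vspace 'rV[R]_n},
        (1 <= \dim H <= n.-1)%N -> one_symmetric H (K `&` [set` H])) :
  euclidean_ball K.
Proof.
have [K_compact K_convex [z0 /interior_dotP[r0 r0_gt0 K_ball]]] := hK.
have K_conv x y s : 0 <= s <= 1 -> K x -> K y -> K ((1 - s) *: x + s *: y).
  by move=> hs Kx Ky; exact: convex_combP.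
have K_turn := one_symmetric_quarter_turn hn hsym.
have [m m_sym] := central_symmetry hn K_compact K_conv r0_gt0 K_ball K_turn.
pose L : set 'rV[R]_n := [set z | K (m + z)].
have L_sym z : L z -> L (- z).
  by move=> /m_sym Kz; apply: (set_congr Kz); vec.
have L_conv x y s : 0 <= s <= 1 -> L x -> L y -> L ((1 - s) *: x + s *: y).
  by move=> hs Lx Ly; apply: (set_congr (K_conv _ _ _ hs Lx Ly)); vec.
have L_closed z :
    (forall e, 0 < e -> exists2 y, L y & dotp (y - z) (y - z) < e) -> L z.
  move=> h; apply: (K_closed K_compact) => e /h[y Ly d]; exists (m + y) => //.
  by rewrite (_ : m + y - (m + z) = y - z) //; vec.
have [M M0 K_bounded] := compact_dot_bounded K_compact.
(* Parallelogram identity for [m + z] and [m - z]. *)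
have L_bounded z : L z -> dotp z z <= (2 * M) ^+ 2.
  move=> Lz; have /K_bounded h1 := Lz; have /K_bounded h2 := L_sym _ Lz.
  have := dot_ge0 m; move: h1 h2; rewrite !dot_sqrD !(dotNl, dotNr).
  by have := exprn_gt0 2 M0; lra.
(* [m + z] is the midpoint of [z0 + z] and the mirror image of [z0 - z]. *)
have L_ball z : dotp z z < r0 ^+ 2 -> L z.
  move=> hz; have half : 0 <= (2^-1 : R) <= 1 by lra.
  have K1 : K (z0 + z) by apply: K_ball; rewrite (_ : z0 + z - z0 = z) //; vec.
  have K2 : K (z0 - z).
    apply: K_ball.
    by rewrite (_ : z0 - z - z0 = - z) ?dotNl ?dotNr ?opprK //; vec.
  apply: (set_congr (K_conv _ _ _ half K1 (m_sym _ K2))).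
  by apply/rowP => ?; rewrite !mxE; field.
have L_turn : quarter_turn_sections L (- m).
  move=> a b aa bb ab; have [s0 [t0 h]] := K_turn a b aa bb ab.
  exists s0, t0 => s t Ls.
  have K1 : K (0 + (s0 + s) *: a + (t0 + t) *: b).
    by apply: (@set_congr _ K _ _ Ls); vec.
  by apply: (set_congr (h _ _ K1)); vec.
have [r r_gt0 LE] := symmetric_body_ball hn L_sym L_conv L_closed L_bounded
  r0_gt0 L_ball L_turn.
exists m, r; split => //; apply/seteqP; split=> x /=; rewrite /edist /enorm.
  move=> Kx; have /LE h : L (x - m) by apply: (set_congr Kx); vec.
  by rewrite -(ger0_norm (ltW r_gt0)) -sqrtr_sqr ler_wsqrtr.
move=> h; have /LE Lx : dotp (x - m) (x - m) <= r ^+ 2.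
  rewrite -(sqr_sqrtr (dot_ge0 (x - m))) lerXn2r ?nnegrE ?sqrtr_ge0 //.
  exact: ltW.
by apply: (@set_congr _ K _ _ Lx); vec.
Qed.
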